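(* Let $1\le k\le n$ and let $\mathcal J=(J_1,\dots,J_n)$ be a Grassmann necklace of type $(k,n)$ whose positroid is connected, with positroid polytope $P_\mathcal J$. For each $i\in[n]$ write $J_i=\{a^i_1<_i a^i_2<_i\cdots<_i a^i_k\}$. Let $E_k$ be the set of $w\in S_n$ with $w_n=n$ and exactly $k$ cyclic left descents. Then $$D_\mathcal J:=\{w\in E_k : \mathrm{cdes}_L(w|_{[i,a^i_j]})\le j-1 \text{ for all } i\in[n],\ j\in[k]\}=\{w\in E_k: I_r(w)\ge_j J_j \text{ for all } r,j\in[n]\},$$ and the simplices $\Delta_{(w)}$, $w\in D_\mathcal J$, are the maximal simplices of a triangulation of $P_\mathcal J$ (in particular $P_\mathcal J=\bigcup_{w\in D_\mathcal J}\Delta_{(w)}$).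
   Context: For $i\in[n]$, the $i$-order on $[n]$ is $i<_i i+1<_i\cdots<_i n<_i 1<_i\cdots<_i i-1$; for $k$-subsets $S=\{s_1<_i\cdots<_i s_k\}$, $T=\{t_1<_i\cdots<_i t_k\}$, $S\le_i T$ means $s_j\le_i t_j$ for all $j$. A Grassmann necklace of type $(k,n)$ is a sequence $(J_1,\dots,J_n)$ of $k$-subsets of $[n]$ such that for every $i$ (indices mod $n$): if $i\in J_i$ then $J_{i+1}=(J_i\setminus\{i\})\cup\{j\}$ for some $j$, and if $i\notin J_i$ then $J_{i+1}=J_i$. Its positroid has bases $\{B\in\binom{[n]}{k}: B\ge_i J_i\ \forall i\}$, and $P_\mathcal J$ is the convex hull of the vectors $e_B=\sum_{i\in B}e_i$ over bases $B$. Connected: the matroid is not a direct sum of two matroids on nonempty ground sets. Cyclic interval: $[i,j]=\{i,i+1,\dots,j\}$ read cyclically mod $n$, totally ordered by the $i$-order. For a finite totally ordered set $X$ and a word $u$ listing each element of $X$ once, $x\in X$ is a cyclic left descent of $u$ if either $x$ is not the maximum of $X$ and the successor of $x$ in $X$ occurs to the left of $x$ in $u$, or $x$ is the maximum of $X$ and the minimum of $X$ occurs to the left of $x$ in $u$; $\mathrm{cDes}_L(u)$ is the set and $\mathrm{cdes}_L(u)$ the number of these. For $w\in S_n$ (one-line notation, $X=[n]$ with its usual order) this defines $\mathrm{cDes}_L(w)$. $w|_{[i,j]}$ is the subword of $w$ consisting of the letters in $[i,j]$, with $[i,j]$ ordered by the $i$-order. For $r\in[n]$, $w^{(r)}$ is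 the cyclic rotation of $w_1\cdots w_n$ ending in $r$, $I_r(w)=\mathrm{cDes}_L(w^{(r)})$, and $\Delta_{(w)}=\mathrm{conv}(e_{I_1(w)},\dots,e_{I_n(w)})$.
   Formalization: The formal theorem assumes n ≥ 2: for n = k = 1 the necklace ({1}) has a connected positroid and P_J = {e_1}, but the only word has no cyclic left descents, so D_J is empty and the claim fails. *)

(* Defs.v *)
From HB Require Import structures.
From mathcomp Require Import all_boot all_order all_algebra all_fingroup.
From mathcomp Require Import classical_sets cardinality reals.

Set Implicit Arguments.
Unset Strict Implicit.
Unset Printing Implicit Defensive.

Import GRing.Theory Num.Theory.

(* The ground set [n] = {1, ..., n} is 'I_n: the element i of [n] is the
   ordinal of value i - 1, and i |-> i + 1 (mod n) is [ordS].
   A finite totally ordered set is given by the list of its elements in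
   increasing order, and a word by the list of its letters. *)

Section Combinatorics.

Variable n : nat.
Implicit Types (i j r : 'I_n) (S T : {set 'I_n}) (u xs : seq 'I_n).

(* i, i+1, ..., n, 1, ..., i-1. *)
Definition cyc_enum i : seq 'I_n := rot i (enum 'I_n).

Definition cyc_le i : rel 'I_n :=
  fun x y => index x (cyc_enum i) <= index y (cyc_enum i).

Definition cyc_sort i S : seq 'I_n := [seq x <- cyc_enum i | x \in S].

(* [all2] also requires both lists to have the same length. *)
Definition gale_le i S T : bool :=
  all2 (cyc_le i) (cyc_sort i S) (cyc_sort i T).

Definition cyc_interval i j : seq 'I_n := [seq x <- cyc_enum i | cyc_le i x j].

(* [next xs x] is the successor of x in xs if x is not the maximum, and the
   minimum of xs if x is the maximum. *)
Definition cDesL xs u : {set 'I_n} :=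
  [set x in xs | index (next xs x) u < index x u].

Definition cdesL xs u : nat := #|cDesL xs u|.

Definition grassmann_necklace (k : nat) (J : 'I_n -> {set 'I_n}) : Prop :=
  (forall i, #|J i| = k) /\
  (forall i, (i \in J i -> exists j, J (ordS i) = (J i :\ i) :|: [set j]) /\
             (i \notin J i -> J (ordS i) = J i)).

Definition positroid (k : nat) (J : 'I_n -> {set 'I_n}) : {set {set 'I_n}} :=
  [set B : {set 'I_n} | (#|B| == k) && [forall i, gale_le i (J i) B]].

Definition one_line (w : 'S_n) : seq 'I_n := [seq w p | p <- enum 'I_n].

Definition rot_to (w : 'S_n) r : seq 'I_n :=
  rot (index r (one_line w)).+1 (one_line w).

Definition I_ (w : 'S_n) r : {set 'I_n} := cDesL (enum 'I_n) (rot_to w r).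

Definition Eset (k : nat) : {set 'S_n} :=
  [set w : 'S_n | [forall p : 'I_n, (p.+1 == n) ==> (w p == p)]
                  && (cdesL (enum 'I_n) (one_line w) == k)].

Definition restr (w : 'S_n) i j : seq 'I_n :=
  [seq x <- one_line w | x \in cyc_interval i j].

(* [a_ J i j] is the (j+1)-st element of J i in the i-order; the default value
   i of [nth] is used only if #|J i| <= j. *)
Definition a_ (J : 'I_n -> {set 'I_n}) i (j : nat) : 'I_n :=
  nth i (cyc_sort i (J i)) j.

(* As j is counted from 0 here, the bound j - 1 of the usual numbering is j. *)
Definition Dset (k : nat) (J : 'I_n -> {set 'I_n}) : {set 'S_n} :=
  [set w in Eset k | [forall i, forall j : 'I_k,
     cdesL (cyc_interval i (a_ J i j)) (restr w i (a_ J i j)) <= j]].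

End Combinatorics.

Section Matroids.

Variable T : finType.
Implicit Types (A : {set T}) (M : {set {set T}}).

(* M is the set of bases of a matroid on the ground set A. *)
Definition matroid_bases A M : Prop :=
  [/\ M != finset.set0,
      (forall B, B \in M -> B \subset A) &
      (forall B1 B2, B1 \in M -> B2 \in M ->
         forall x, x \in B1 :\: B2 ->
         exists2 y, y \in B2 :\: B1 & (B1 :\ x) :|: [set y] \in M)].

Definition connected_matroid M : Prop :=
  ~ exists A M1 M2,
      [/\ A != finset.set0, ~: A != finset.set0, matroid_bases A M1, matroid_bases (~: A) M2
        & M = [set B1 :|: B2 | B1 in M1, B2 in M2]].

End Matroids.

Local Open Scope classical_set_scope.
Local Open Scope ring_scope.

Section Geometry.

Variables (R : realType) (n : nat).
Implicit Types (S F P : set 'rV[R]_n) (K : set (set 'rV[R]_n)).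

Definition evec (B : {set 'I_n}) : 'rV[R]_n := \row_(i < n) (i \in B)%:R.

(* The convex hull of the points v i, i \in A; it is empty if A is. *)
Definition conv_hull (I : finType) (A : {set I}) (v : I -> 'rV[R]_n) :
    set 'rV[R]_n :=
  [set x | exists c : I -> R,
     [/\ forall i, i \in A -> 0 <= c i,
         \sum_(i in A) c i = 1 &
         x = \sum_(i in A) c i *: v i]].

Definition affinely_independent (m : nat) (v : 'I_m -> 'rV[R]_n) : Prop :=
  forall c : 'I_m -> R,
    \sum_i c i = 0 -> \sum_i c i *: v i = 0 -> forall i, c i = 0.

(* The case m = 0 gives the empty simplex, which is a face of every simplex. *)
Definition simplex S : Prop :=
  exists (m : nat) (v : 'I_m -> 'rV[R]_n),
    affinely_independent v /\ S = conv_hull [set: 'I_m]%SET v.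

Definition face F S : Prop :=
  exists (m : nat) (v : 'I_m -> 'rV[R]_n) (A : {set 'I_m}),
    [/\ affinely_independent v, S = conv_hull [set: 'I_m]%SET v
      & F = conv_hull A v].

Definition triangulation K P : Prop :=
  [/\ finite_set K,
      (forall S, K S -> simplex S),
      (forall S F, K S -> face F S -> K F),
      (forall S S', K S -> K S' -> face (S `&` S') S /\ face (S `&` S') S')
    & P = \bigcup_(S in K) S].

Definition maximal_simplices K : set (set 'rV[R]_n) :=
  [set S | K S /\ forall S', K S' -> S `<=` S' -> S' = S].

Definition positroid_polytope (k : nat) (J : 'I_n -> {set 'I_n}) :
    set 'rV[R]_n :=
  conv_hull (positroid k J) evec.

Definition Delta (w : 'S_n) : set 'rV[R]_n :=
  conv_hull [set: 'I_n]%SET (fun r => evec (I_ w r)).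

End Geometry.

Arguments positroid_polytope R {n} k J.
Arguments Delta R {n} w.

(* Main.v *)
(* A point x with coordinate sum k sends the letters to points of the circle R/Z,
   the step from i to i + 1 having length x_i.  A word w together with weights
   c_r >= 0 of sum 1 is the same thing as such a configuration: c_r is the gap after
   the letter r, and I_r(w) is the set of steps that run over this gap, so that
   x = \sum_r c_r e_{I_r(w)}.  Unrolling the circle at the end of w turns the
   configuration into a height function on the letters, decreasing along w.
   Reading I_r off the circle shows that the sets carrying positive weight depend
   only on x; hence two simplices meet in a common face.

   If no sum of x over a proper cyclic interval is an integer, the points on the
   circle are distinct and all gaps are positive.  If moreover x lies in the
   positroid polytope, the inequalities x([i, a^i_j)) <= j - 1, valid at the
   vertices, then hold at every I_r(w), because the number of elements of I_r(w)
   in [i, a^i_j) takes only the values q and q - 1, where q is the number of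
   cyclic left descents of w restricted to [i, a^i_j].  Such generic x are dense
   in the polytope: if all bases had the same number of elements in a proper
   cyclic interval, the positroid would be a direct sum. *)

Require Import Defs.
From mathcomp Require Import all_boot all_order all_algebra all_fingroup.
From mathcomp Require Import zify.
Set Implicit Arguments.
Unset Strict Implicit.
Unset Printing Implicit Defensive.

(** * Cyclic intervals and the Gale order *)

Section NatLists.
Implicit Types s t : seq nat.

Lemma nth_sorted_ltn s i j :
  sorted ltn s -> i < j < size s -> nth 0 s i < nth 0 s j.
Proof.
move=> ss /andP[ij js]; apply: (sorted_ltn_nth ltn_trans 0 ss) => //.
by rewrite inE (ltn_trans ij).
Qed.

Lemma nth_sorted_leq s i j :
  sorted ltn s -> i <= j < size s -> nth 0 s i <= nth 0 s j.
Proof.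
move=> ss /andP[]; rewrite leq_eqVlt => /predU1P[-> //|ij js].
by rewrite ltnW // nth_sorted_ltn // ij.
Qed.

Lemma count_ltn_sorted s j :
  sorted ltn s -> j < size s -> count (fun x => x < nth 0 s j) s = j.
Proof.
move=> ss js.
have -> : count (fun x => x < nth 0 s j) s = count (fun x => x < nth 0 s j) (take j s ++ drop j s).
  by rewrite cat_take_drop.
rewrite count_cat.
have /eqP -> : count (fun x => x < nth 0 s j) (drop j s) == 0.
  rewrite -leqn0 leqNgt -has_count; apply/hasPn => x /(nthP 0) [i]; rewrite size_drop nth_drop => hi <-.
  by rewrite -leqNgt nth_sorted_leq // leq_addr -ltn_subRL.
rewrite addn0.
have /eqP -> : count (fun x => x < nth 0 s j) (take j s) == size (take j s).
  rewrite -all_count; apply/(all_nthP 0) => i; rewrite size_take js => hi.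
  by rewrite nth_take // nth_sorted_ltn // hi.
by rewrite size_take js.
Qed.

Lemma all2_leq_count s t d :
  all2 leq s t -> count (fun x => x < d) t <= count (fun x => x < d) s.
Proof.
elim: s t => [|x s IH] [|y t] //= /andP[xy /IH]; lia.
Qed.

(** If entry j of [t] were below entry j of [s], the first j + 1 entries of the sorted list [t]
    would lie below that threshold, one more than the count allows. So the entries of [s] are the
    only thresholds to test. *)
Lemma all2_leq_nth s t : sorted ltn t -> size s = size t ->
  (forall j, j < size s -> count (fun x => x < nth 0 s j) t <= j) -> all2 leq s t.
Proof.
move=> st sz H; rewrite all2E sz eqxx /=.
apply/(all_nthP (0, 0)) => j; rewrite size_zip sz minnn => jt.
rewrite nth_zip //= leqNgt; apply/negP => lt.
have := H j; rewrite sz => /(_ jt); rewrite leqNgt => /negP; apply.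
have -> : count (fun x => x < nth 0 s j) t = count (fun x => x < nth 0 s j) (take j.+1 t ++ drop j.+1 t).
  by rewrite cat_take_drop.
rewrite count_cat.
have /eqP -> : count (fun x => x < nth 0 s j) (take j.+1 t) == size (take j.+1 t).
  rewrite -all_count; apply/(all_nthP 0) => i; rewrite size_takel // => hi.
  rewrite nth_take //; apply: leq_ltn_trans lt.
  by apply: nth_sorted_leq => //; lia.
by rewrite size_takel //; lia.
Qed.

End NatLists.

Section Cyclic.
Variable n : nat.
Implicit Types (i j x y o : 'I_n) (S T A B : {set 'I_n}).

Definition shift d i : 'I_n := iter d (@ordS n) i.

Lemma shiftS d i : shift d.+1 i = ordS (shift d i).
Proof. by []. Qed.

Lemma val_shift d i : shift d i = (i + d) %% n :> nat.
Proof.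
elim: d => [|d IH] /=; first by rewrite addn0 modn_small.
by rewrite IH -addn1 modnDml addn1 addnS.
Qed.

Lemma shiftD d e i : shift d (shift e i) = shift (d + e) i.
Proof. by rewrite /shift iterD. Qed.

Lemma shiftn i : shift n i = i.
Proof. by apply: ord_inj; rewrite val_shift modnDr modn_small. Qed.

Lemma cyc_enumE i : cyc_enum i = traject (@ordS n) i n.
Proof.
apply: (@eq_from_nth _ i).
  by rewrite size_rot size_enum_ord size_traject.
move=> d; rewrite size_rot size_enum_ord => dn.
apply: ord_inj; rewrite nth_traject // -/(shift d i) val_shift.
rewrite nth_cat size_drop size_enum_ord nth_drop.
case: ltnP => h; first by rewrite modn_small; [apply: nth_enum_ord; lia | lia].
rewrite nth_take; last by lia.
have -> : i + d = d - (n - i) + n by have := ltn_ord i; lia.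
by rewrite modnDr modn_small; [apply: nth_enum_ord; lia | lia].
Qed.

Lemma cyc_enum_uniq i : uniq (cyc_enum i).
Proof. by rewrite rot_uniq enum_uniq. Qed.

Lemma mem_cyc_enum i x : x \in cyc_enum i.
Proof. by rewrite mem_rot mem_enum. Qed.

Definition dist i x : nat := index x (cyc_enum i).

Lemma dist_lt i x : dist i x < n.
Proof. by rewrite -[X in _ < X](size_enum_ord n) -(size_rot i) index_mem mem_cyc_enum. Qed.

Lemma dist_shift i d : d < n -> dist i (shift d i) = d.
Proof.
move=> dn; have -> : shift d i = nth i (cyc_enum i) d by rewrite cyc_enumE nth_traject.
by rewrite /dist index_uniq ?cyc_enum_uniq // size_rot size_enum_ord.
Qed.

Lemma shift_dist i x : shift (dist i x) i = x.
Proof.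
have -> : shift (dist i x) i = nth i (cyc_enum i) (dist i x).
  by rewrite cyc_enumE nth_traject // dist_lt.
exact/nth_index/mem_cyc_enum.
Qed.

Lemma dist_eq0 i x : (dist i x == 0) = (x == i).
Proof.
apply/eqP/eqP => [h|->]; first by rewrite -(shift_dist i x) h.
by have := @dist_shift i 0; apply; apply: leq_ltn_trans (ltn_ord i).
Qed.

Lemma dist_inj i : injective (dist i).
Proof. by move=> x y h; rewrite -(shift_dist i x) h shift_dist. Qed.

(** A half-open arc. Giving start and length, rather than two endpoints, makes both the empty set
    and the whole circle arcs. *)
Definition carc i d : {set 'I_n} := [set x | dist i x < d].

Lemma carc0 i : carc i 0 = set0.
Proof. by apply/setP => x; rewrite !inE. Qed.

Lemma carcT i d : n <= d -> carc i d = [set: 'I_n].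
Proof. by move=> nd; apply/setP => x; rewrite !inE (leq_trans (dist_lt i x)). Qed.

Lemma carcS i d : d < n -> carc i d.+1 = shift d i |: carc i d.
Proof.
move=> dn; apply/setP => x; rewrite !inE ltnS leq_eqVlt.
by rewrite -[d in dist i x == d](dist_shift i dn) (inj_eq (@dist_inj i)).
Qed.

Lemma shift_notin_carc i d : d < n -> shift d i \notin carc i d.
Proof. by move=> dn; rewrite inE dist_shift // ltnn. Qed.

Lemma card_carcS A i d : d < n -> #|A :&: carc i d.+1| = (shift d i \in A) + #|A :&: carc i d|.
Proof.
move=> dn; rewrite carcS // setIUr.
have [hA|hA] := boolP (shift d i \in A).
  have -> : A :&: [set shift d i] = [set shift d i] by apply/setIidPr; rewrite sub1set.
  by rewrite cardsU1 !inE dist_shift // ltnn andbF.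
suff -> : A :&: [set shift d i] = set0 by rewrite set0U.
by apply/setP => x; rewrite !inE; case: eqP => [->|]; rewrite ?(negbTE hA) ?andbF.
Qed.

Lemma dist_shiftl o p x : p < n ->
  dist (shift p o) x = if p <= dist o x then dist o x - p else dist o x + n - p.
Proof.
move=> pn; have xn := dist_lt o x.
case: leqP => h.
  have {1}-> : x = shift (dist o x - p) (shift p o).
    by rewrite shiftD subnK // shift_dist.
  by rewrite dist_shift //; lia.
have {1}-> : x = shift (dist o x + n - p) (shift p o).
  rewrite shiftD subnK; last by lia.
  by rewrite -shiftD shiftn shift_dist.
by rewrite dist_shift //; lia.
Qed.

Lemma carc_compl i d : d <= n -> carc (shift d i) (n - d) = ~: carc i d.
Proof.
rewrite leq_eqVlt => /predU1P[->|dn].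
  by rewrite subnn carc0 carcT // setCT.
apply/setP => x; rewrite !inE dist_shiftl // -leqNgt.
by have := dist_lt i x; case: (leqP d (dist i x)) => h1 h2; apply/idP/idP; lia.
Qed.

Section Gale.
Variable i : 'I_n.

Definition dists S := [seq dist i x | x <- cyc_sort i S].

Lemma size_cyc_sort S : size (cyc_sort i S) = #|S|.
Proof.
rewrite -(card_uniqP _) ?filter_uniq ?cyc_enum_uniq //.
by apply: eq_card => x; rewrite mem_filter mem_cyc_enum andbT.
Qed.

Lemma sorted_dists S : sorted ltn (dists S).
Proof.
rewrite sorted_map /cyc_sort.
apply: sorted_filter; first by move=> x y z; exact: ltn_trans.
apply/(sortedP i) => d; rewrite size_rot size_enum_ord => dn.
by rewrite /= /dist !index_uniq ?cyc_enum_uniq ?size_rot ?size_enum_ord // ltnW.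
Qed.

Lemma count_dists S d : count (fun e => e < d) (dists S) = #|S :&: carc i d|.
Proof.
rewrite count_map -size_filter -(card_uniqP _) ?filter_uniq ?cyc_enum_uniq //.
by apply: eq_card => x; rewrite !mem_filter mem_cyc_enum andbT !inE andbC.
Qed.

Lemma gale_leE S T : gale_le i S T = all2 leq (dists S) (dists T).
Proof.
rewrite /gale_le /dists; elim: (cyc_sort i S) (cyc_sort i T) => [|x s IH] [|y t] //=.
by rewrite IH.
Qed.

Lemma gale_le_carc S T d : gale_le i S T -> #|T :&: carc i d| <= #|S :&: carc i d|.
Proof. by rewrite gale_leE -!count_dists => /all2_leq_count. Qed.

(** Only thresholds at elements of [S] matter; for [S] equal to [J i] they are the arcs $[i, a^i_j)$
    behind the inequalities of [Dset]. *)
Lemma gale_le_nth S T : #|S| = #|T| ->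
  (forall j : nat, j < #|S| -> #|T :&: carc i (dist i (nth i (cyc_sort i S) j))| <= j) ->
  gale_le i S T.
Proof.
move=> ST H; rewrite gale_leE; apply: all2_leq_nth (sorted_dists _) _ _ => [|j].
  by rewrite !size_map !size_cyc_sort.
rewrite size_map size_cyc_sort => jS.
by rewrite (nth_map i) ?size_cyc_sort // count_dists H.
Qed.

Lemma card_carc_nth S (j : nat) : j < #|S| -> #|S :&: carc i (dist i (nth i (cyc_sort i S) j))| = j.
Proof.
move=> jS; rewrite -(nth_map i 0) ?size_cyc_sort // -count_dists.
by rewrite count_ltn_sorted ?sorted_dists // size_map size_cyc_sort.
Qed.

Lemma gale_leP S T : #|S| = #|T| ->
  reflect (forall d, d <= n -> #|T :&: carc i d| <= #|S :&: carc i d|) (gale_le i S T).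
Proof.
move=> ST; apply: (iffP idP) => [h d _|H]; first exact: gale_le_carc.
apply: gale_le_nth => // j jS; rewrite -[j in _ <= j](card_carc_nth jS).
exact/H/ltnW/dist_lt.
Qed.

End Gale.

End Cyclic.

(** * Positroids *)

Section Positroids.
Variables (n k : nat) (J : 'I_n -> {set 'I_n}).
Hypothesis hJ : grassmann_necklace k J.
Implicit Types (i o x y : 'I_n) (A B X : {set 'I_n}) (p q d : nat).

(** The step of the necklace from index q to q + 1 can remove only q, so [x] stays until the index
    has passed [x]. *)
Lemma necklace_survive p i x : p <= dist i x -> x \in J i -> x \in J (shift p i).
Proof.
elim: p => [//|p IH] px xJ; have /IH/(_ xJ) xJp := ltnW px.
rewrite shiftS; have [/= h1 h2] := hJ.2 (shift p i).
have [hq|/h2-> //] := boolP (shift p i \in J (shift p i)).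
have [y ->] := h1 hq; rewrite !inE xJp andbT.
have -> : x != shift p i; last by [].
have pn : p < n := ltn_trans px (dist_lt i x).
by apply: contraTneq px => ->; rewrite dist_shift ?ltnn.
Qed.

Lemma positroidP B :
  reflect (#|B| = k /\
           forall i d, d <= n -> #|B :&: carc i d| <= #|J i :&: carc i d|)
          (B \in positroid k J).
Proof.
rewrite inE; apply: (iffP andP) => [[/eqP Bk /forallP h]|[Bk h]].
  by split=> // i d dn; apply: gale_le_carc.
split; first exact/eqP; apply/forallP => i; apply/gale_leP; last exact: h.
by rewrite hJ.1.
Qed.

(** If the arc from [o] does not contain [i], the elements of [J i] in it survive on the way from
    [i] round to [o]. If it contains [i], the elements of [J o] outside it survive up to [i], and
    counting complements gives the bound, since both sets have k elements. *)
Lemma necklace_positroid i : J i \in positroid k J.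
Proof.
apply/positroidP; split=> [|o d dn]; first exact: hJ.1.
have := dist_lt o i; have := shift_dist o i; move: (dist o i) => a ai an.
case: (leqP d a) => da.
  apply: subset_leq_card; apply/subsetP => x; rewrite !inE => /andP[xJ xd].
  rewrite xd andbT; have -> : o = shift (n - a) i.
    by rewrite -ai shiftD subnK ?shiftn // ltnW.
  apply: necklace_survive xJ; by rewrite -ai dist_shiftl //; case: (leqP a (dist o x)); lia.
have /subset_leq_card : J o :\: carc o d \subset J i :\: carc o d.
  apply/subsetP => x; rewrite !inE => /andP[xd xJ]; rewrite xd -ai /=.
  by apply: necklace_survive xJ; lia.
have := cardsID (carc o d) (J o); have := cardsID (carc o d) (J i).
rewrite !hJ.1; lia.
Qed.

(** Cutting the circle at [o] turns the arcs that do not cross the cut into intervals of natural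
    numbers. *)
Definition seg o p q : {set 'I_n} := carc (shift p o) (q - p).

Lemma mem_seg o p q x : p <= q <= n -> (x \in seg o p q) = (p <= dist o x < q).
Proof.
move=> /andP[pq qn]; rewrite inE.
case: (ltnP p n) => pn; last first.
  have -> : q - p = 0 by lia.
  by rewrite ltn0; apply/esym/negbTE; have := dist_lt o x; lia.
rewrite dist_shiftl //; have := dist_lt o x.
by case: (leqP p (dist o x)) => h1 h2; apply/idP/idP; lia.
Qed.

Lemma card_seg_cat A o p q r : p <= q <= r -> r <= n ->
  #|A :&: seg o p r| = #|A :&: seg o p q| + #|A :&: seg o q r|.
Proof.
move=> pqr rn; rewrite -(cardsID (seg o p q) (A :&: seg o p r)); congr (_ + _); apply: eq_card => x.
  by rewrite !in_setI !mem_seg; try lia; case: (x \in A) => //=; apply/idP/idP; lia.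
by rewrite in_setD !in_setI !mem_seg; try lia; case: (x \in A); rewrite ?andbF //=; apply/idP/idP; lia.
Qed.

(** The rank of the segment in the positroid: an upper bound by [positroid_seg], attained because
    [J (shift p o)] is itself a basis. *)
Definition srank o p q := #|J (shift p o) :&: seg o p q|.

Lemma positroid_seg B o p q : B \in positroid k J -> q <= n ->
  #|B :&: seg o p q| <= srank o p q.
Proof. by move=> /positroidP[_ h] qn; apply: h; lia. Qed.

Lemma necklace_seg_sub o p p' q q' : p <= p' <= q -> q <= q' <= n ->
  J (shift p o) :&: seg o q q' \subset J (shift p' o) :&: seg o q q'.
Proof.
move=> pp qq; apply/subsetP => x; rewrite !in_setI => /andP[xJ xs]; rewrite xs andbT.
move: xs; rewrite mem_seg // => xq; have := dist_lt o x => xn.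
have -> : shift p' o = shift (p' - p) (shift p o) by rewrite shiftD subnK //; lia.
apply: necklace_survive xJ; rewrite dist_shiftl; last by lia.
by case: (leqP p (dist o x)); lia.
Qed.

(* The rank function is submodular on crossing intervals: an element that
   J_p has beyond q is still there in J_p'. *)
Lemma srank_submod o p p' q q' : p <= p' <= q -> q <= q' <= n ->
  srank o p q' + srank o p' q <= srank o p q + srank o p' q'.
Proof.
move=> pp qq; rewrite /srank.
rewrite (@card_seg_cat _ o p q q'); try lia.
rewrite (@card_seg_cat _ o p' q q'); try lia.
have := subset_leq_card (@necklace_seg_sub o p p' q q' pp qq); lia.
Qed.

Lemma card_exchange A B x y : x \in B -> y \notin B ->
  #|((B :\ x) :|: [set y]) :&: A| + (x \in A) = #|B :&: A| + (y \in A).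
Proof.
move=> xB yB; have xy : x != y by apply: contraNneq yB => <-.
rewrite (cardsD1 y (_ :&: A)) (cardsD1 x (B :&: A)) !inE eqxx xB orbT /=.
have -> : ((B :\ x) :|: [set y]) :&: A :\ y = (B :&: A) :\ x; last by rewrite addnC addnA addnAC.
apply/setP => z; rewrite !inE; case: (z =P y) => [->|_] /=; last by rewrite orbF andbA.
by rewrite (negbTE yB) !andbF.
Qed.

(* An obstruction to exchanging x for y is a tight interval containing y and not
   x.  Tight intervals that overlap have a tight union, so the positions crossed
   by no tight interval cut the line x+1, ..., x-1 into tight intervals and
   elements outside B2 \ B1; on each of these pieces B1 has at least as many
   elements as B2. *)
Lemma positroid_exchange B1 B2 x :
  B1 \in positroid k J -> B2 \in positroid k J -> x \in B1 :\: B2 ->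
  exists2 y, y \in B2 :\: B1 & (B1 :\ x) :|: [set y] \in positroid k J.
Proof.
move=> M1 M2; rewrite inE => /andP[xB2 xB1]; apply/exists_inP; apply: contraT.
rewrite negb_exists => /forallP noex.
have n0 : 0 < n := leq_ltn_trans (leq0n _) (ltn_ord x).
(* Cutting just after [x] puts [x] at the last position n - 1. An arc avoiding [x] is then a segment
   with right end below n, which is why [q] in [obstr] is an ordinal. *)
pose o := ordS x.
have ox : shift n.-1 o = x by rewrite -[o]/(shift 1 x) shiftD addn1 prednK // shiftn.
have dox : dist o x = n.-1 by rewrite -{1}ox dist_shift // prednK.
pose tight p q := #|B1 :&: seg o p q| == srank o p q.
have obstr y : y \in B2 :\: B1 ->
    exists2 p, p <= dist o y & exists q : 'I_n, (dist o y < q) && tight p q.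
  move=> hy; have := noex y; rewrite hy /= => /positroidP hC.
  have yB1 : y \notin B1 by move: hy; rewrite inE => /andP[].
  have Ck : #|(B1 :\ x) :|: [set y]| = k.
    have := @card_exchange setT B1 x y xB1 yB1.
    by rewrite !setIT !inE; have [-> _] := positroidP _ M1; lia.
  have : ~~ [forall i, forall d : 'I_n.+1,
      #|((B1 :\ x) :|: [set y]) :&: carc i d| <= #|J i :&: carc i d|].
    apply/negP => /forallP h; apply: hC; split=> // i d dn.
    by have /forallP/(_ (inord d)) := h i; rewrite inordK.
  rewrite negb_forall => /existsP[i]; rewrite negb_forall => /existsP[d].
  rewrite -ltnNge => lt; have dn : d <= n by rewrite -ltnS.
  (* The exchange raises the count only on arcs containing [y] but not [x], and by one; a violated
     bound was therefore tight for [B1]. *)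
  have := @card_exchange (carc i d) B1 x y xB1 yB1.
  have [_ /(_ i d dn) le] := positroidP _ M1.
  case: (boolP (x \in carc i d)); case: (boolP (y \in carc i d)) => yA xA; try lia.
  move=> eqc; have := dist_lt o i; have := shift_dist o i; move: (dist o i) => p pi pn.
  have pd : p + d < n.
    move: xA; rewrite inE -pi dist_shiftl // dox; case: (leqP p n.-1); lia.
  have ypq : p <= dist o y < p + d.
    by rewrite -mem_seg; [rewrite /seg pi addKn | lia].
  exists p; first by lia.
  exists (Ordinal pd); rewrite /= /tight /srank /seg pi addKn; lia.
have key q : q < n -> (forall p' q', p' < q < q' -> q' < n -> ~~ tight p' q') ->
    #|B2 :&: carc o q| <= #|B1 :&: carc o q|.
  elim/ltn_ind: q => -[|q] IH qn unc; first by rewrite carc0 !setI0.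
  pose P p := (p <= q) && [exists q' : 'I_n, (q < q') && tight p q'].
  have [/existsP exP|/existsP noP'] := boolP [exists p : 'I_n, P p]; last first.
    have noP : ~ exists p, P p.
      move=> [p Pp]; apply: noP'; have pn : p < n by have /andP[] := Pp; lia.
      by exists (Ordinal pn).
    rewrite !card_carcS; try lia.
    have hq : q < n by lia.
    suff ler : shift q o \in B2 -> shift q o \in B1.
      have : #|B2 :&: carc o q| <= #|B1 :&: carc o q|.
        apply: IH => // p' q' pq qn'; apply/negP => tpq; apply: noP.
        exists p'; apply/andP; split; first by lia.
        by apply/existsP; exists (Ordinal qn'); rewrite tpq /=; lia.
      by move/implyP: ler; case: (_ \in B2); case: (_ \in B1) => //= _; lia.
    move=> h2; apply: contraT => h1.
    have [|p hp [q' hq']] := obstr (shift q o); first by rewrite inE h1.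
    exfalso; apply: noP; exists p; rewrite dist_shift // in hp hq'.
    by rewrite /P hp; apply/existsP; exists q'.
  have {}exP : exists p, P p by have [p Pp] := exP; exists p.
  (* Among the tight segments over position [q], take one starting furthest left; it ends at q + 1,
     which no tight segment crosses. *)
  case: (ex_minnP exP) => p /andP[pq /existsP[q' /andP[qq' tpq]]] pmin.
  have q'E : nat_of_ord q' = q.+1.
    apply/eqP; rewrite eqn_leq qq' andbT leqNgt; apply/negP => lt.
    by have /negP := unc p q' ltac:(lia) (ltn_ord q'); apply.
  rewrite q'E in tpq.
  have IHp : #|B2 :&: carc o p| <= #|B1 :&: carc o p|.
    apply: IH; try lia.
    (* A tight segment across [p] would yield one over [q] starting further left: either itself, or
       its union with the segment from [p] to q + 1. *)
    move=> p1 q1 pq1 q1n; apply/negP => t1.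
    have Pp1 : P p1 -> False by move=> /pmin; lia.
    apply: Pp1; rewrite /P; apply/andP; split; first by lia.
    apply/existsP; case: (ltnP q q1) => qq1.
      by exists (Ordinal q1n); rewrite /= qq1.
    exists (Ordinal qn); rewrite /= ltnSn /=.
    have := @srank_submod o p1 p q1 q.+1; rewrite /tight in t1 tpq *.
    have := @card_seg_cat B1 o p1 q1 q.+1.
    have := @card_seg_cat B1 o p q1 q.+1.
    have := @positroid_seg B1 o p1 q.+1 M1 (ltnW qn).
    have := @positroid_seg B1 o p q1 M1 (ltnW q1n).
    lia.
  have pre B : #|B :&: carc o q.+1| = #|B :&: carc o p| + #|B :&: seg o p q.+1|.
    have := @card_seg_cat B o 0 p q.+1; rewrite /seg /= !subn0; apply; lia.
  rewrite !pre; have := @positroid_seg B2 o p q.+1 M2 (ltnW qn).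
  move/eqP: tpq => <-; lia.
(* No segment with right end below n crosses n - 1. Beyond this position only [x] remains, and it
   lies in [B1] alone, so the two bases could not both have k elements. *)
have : #|B2 :&: carc o n.-1| <= #|B1 :&: carc o n.-1|.
  by apply: key => [|p' q']; lia.
have tot B : B \in positroid k J -> (x \in B) + #|B :&: carc o n.-1| = k.
  move=> /positroidP[Bk _]; have := @card_carcS n B o n.-1.
  by rewrite prednK // carcT // setIT ox Bk => ->.
by have := tot _ M1; have := tot _ M2; rewrite xB1 (negbTE xB2); lia.
Qed.

(* Here the only intervals that mix the two sides start before s and end after
   it; J_p and J_s agree on the complement, since J_p loses only elements of the
   arc on the way to J_s and both have k - m elements outside the arc. *)
Lemma positroid_glue o s m B B' X p d : s <= n ->
  (forall C, C \in positroid k J -> #|C :&: carc o s| = m) ->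
  B \in positroid k J -> B' \in positroid k J -> #|X| = k ->
  X :&: carc o s = B :&: carc o s -> X :&: ~: carc o s = B' :&: ~: carc o s ->
  p < s -> d <= n ->
  #|X :&: carc (shift p o) d| <= #|J (shift p o) :&: carc (shift p o) d|.
Proof.
move=> sn hm MB MB' Xk XB XB' ps dn; have [Bk hB] := positroidP _ MB.
have inS q r : q <= r <= s -> #|X :&: seg o q r| = #|B :&: seg o q r|.
  move=> qr; apply: eq_card => x; rewrite !in_setI.
  have [xs|] := boolP (x \in seg o q r); last by rewrite !andbF.
  have : (x \in X :&: carc o s) = (x \in B :&: carc o s) by rewrite XB.
  by rewrite !in_setI; move: xs; rewrite mem_seg ?inE; [case: ltnP; rewrite ?andbT //; lia | lia].
have inSC q r : s <= q <= r -> r <= n -> #|X :&: seg o q r| = #|B' :&: seg o q r|.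
  move=> qr rn; apply: eq_card => x; rewrite !in_setI.
  have [xs|] := boolP (x \in seg o q r); last by rewrite !andbF.
  have : (x \in X :&: ~: carc o s) = (x \in B' :&: ~: carc o s) by rewrite XB'.
  by rewrite !in_setI in_setC; move: xs; rewrite mem_seg ?inE; [case: ltnP; rewrite ?andbT //; lia | lia].
have segE : carc (shift p o) d = seg o p (p + d) by rewrite /seg addKn.
case: (leqP (p + d) s) => pds.
  by rewrite segE inS ?leq_addr // -segE hB.
case: (leqP (p + d) n) => pdn.
  rewrite segE !(@card_seg_cat _ o p s (p + d)); try lia.
  rewrite inS; last by lia.
  rewrite inSC; try lia.
  have h1 : #|B :&: seg o p s| <= srank o p s by exact: positroid_seg.
  have h2 : #|B' :&: seg o s (p + d)| <= srank o s (p + d) by exact: positroid_seg.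
  suff eqJ : J (shift p o) :&: seg o s (p + d) = J (shift s o) :&: seg o s (p + d).
    by rewrite eqJ; apply: leq_add.
  have -> : seg o s (p + d) = ~: carc o s :&: seg o s (p + d).
    apply/esym/setIidPr/subsetP => x; rewrite mem_seg; last by lia.
    by rewrite in_setC inE; lia.
  rewrite !setIA; congr (_ :&: _); apply/eqP; rewrite eqEcard; apply/andP; split.
    apply/subsetP => x; rewrite !in_setI in_setC => /andP[xJ xs]; rewrite xs andbT.
    have -> : shift s o = shift (s - p) (shift p o) by rewrite shiftD subnK // ltnW.
    apply: necklace_survive xJ; move: xs; rewrite inE dist_shiftl; last by lia.
    by case: (leqP p (dist o x)); lia.
  have := hm _ (necklace_positroid (shift p o)); have := hm _ (necklace_positroid (shift s o)).
  have := cardsID (carc o s) (J (shift p o)); have := cardsID (carc o s) (J (shift s o)).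
  by rewrite !hJ.1 !setDE; lia.
(* Here the arc wraps past [o]. Its complement is a segment inside the first [s] positions, where
   [X] agrees with [B], and both sets have k elements. *)
have := hB (shift p o) d dn.
have -> : carc (shift p o) d = ~: seg o (p + d - n) p.
  rewrite -[LHS]setCK -carc_compl // shiftD /seg; congr (~: carc _ _); last by lia.
  have <- : p + d - n + n = d + p by lia.
  by rewrite -shiftD shiftn.
rewrite -!setDE.
have := cardsID (seg o (p + d - n) p) X; have := cardsID (seg o (p + d - n) p) B.
rewrite inS; last by lia.
rewrite Xk Bk; lia.
Qed.

Lemma positroid_direct_sum o s m B B' : 0 < s < n ->
  (forall C, C \in positroid k J -> #|C :&: carc o s| = m) ->
  B \in positroid k J -> B' \in positroid k J ->
  (B :&: carc o s) :|: (B' :&: ~: carc o s) \in positroid k J.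
Proof.
move=> sn hm MB MB'; set X := _ :|: _.
have XB : X :&: carc o s = B :&: carc o s.
  by rewrite setIUl -!setIA setIid [~: _ :&: _]setIC setICr setI0 setU0.
have XB' : X :&: ~: carc o s = B' :&: ~: carc o s.
  by rewrite setIUl -!setIA setIid setICr setI0 set0U.
have Xk : #|X| = k.
  have [B'k _] := positroidP _ MB'.
  have := cardsID (carc o s) X; have := cardsID (carc o s) B'.
  by rewrite !setDE XB XB' !hm //; lia.
apply/positroidP; split=> // i d dn.
have := dist_lt o i; have := shift_dist o i; move: (dist o i) => p <- pn.
case: (ltnP p s) => ps; first by apply: (positroid_glue (s := s) (m := m) (B := B) (B' := B')) => //; lia.
(* An arc starting in the complement is handled by the same lemma seen from [shift s o], with [B]
   and [B'] exchanged and [k - m] in place of [m]. *)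
have -> : shift p o = shift (p - s) (shift s o) by rewrite shiftD subnK.
have cS : carc (shift s o) (n - s) = ~: carc o s by apply: carc_compl; lia.
apply: (positroid_glue (s := n - s) (m := k - m) (B := B') (B' := B)); rewrite ?cS ?setCK //; try lia.
move=> C MC; have [Ck _] := positroidP _ MC.
by have := cardsID (carc o s) C; rewrite setDE hm // Ck; lia.
Qed.

(** A constant count would let bases be recombined freely across the arc, which splits the
    positroid. Since [m] is arbitrary, the lemma yields a basis whose count differs from that of any
    given one. *)
Lemma connected_card_carc_neq o s m : connected_matroid (positroid k J) ->
  0 < s < n -> exists2 B, B \in positroid k J & #|B :&: carc o s| != m.
Proof.
move=> hc sn; apply/exists_inP; apply: contra_notT hc => /exists_inPn hm'.
have hm C : C \in positroid k J -> #|C :&: carc o s| = m.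
  by move=> /hm'; rewrite negbK => /eqP.
set S := carc o s in hm.
exists S, [set B :&: S | B in positroid k J], [set B :&: ~: S | B in positroid k J].
have glue := positroid_direct_sum sn hm.
have restr_bases (A : {set 'I_n}) :
    (forall B B', B \in positroid k J -> B' \in positroid k J ->
       (B :&: A) :|: (B' :&: ~: A) \in positroid k J) ->
    matroid_bases A [set B :&: A | B in positroid k J].
  move=> gl; split.
  - by apply/set0Pn; exists (J o :&: A); apply/imset_f/necklace_positroid.
  - by move=> _ /imsetP[B _ ->]; exact: subsetIr.
  move=> _ _ /imsetP[B1 M1 ->] /imsetP[B2 M2 ->] x.
  rewrite !inE negb_and => /andP[xB2 /andP[xB1 xA]]; rewrite xA orbF in xB2.
  (* Exchanging against a basis that equals [B2] on [A] and [B1] off [A] forces the incoming element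
     to lie in [A]. *)
  have M3 := gl _ _ M2 M1.
  have xd : x \in B1 :\: ((B2 :&: A) :|: (B1 :&: ~: A)).
    by rewrite !inE xB1 xA (negbTE xB2).
  have [y yd MC] := positroid_exchange M1 M3 xd; move: yd.
  rewrite !inE => /andP[yB1]; rewrite (negbTE yB1) orbF => /andP[yB2 yA].
  exists y; first by rewrite !inE yB2 yA (negbTE yB1).
  apply/imsetP; exists (B1 :\ x :|: [set y]) => //; apply/setP => z; rewrite !inE.
  by case: eqP => [->|] //=; case: eqP => [->|]; rewrite ?yA ?orbF ?orbT ?andbA.
split.
- by apply/set0Pn; exists o; rewrite inE (eqP (_ : dist o o == 0)) ?dist_eq0 //; case/andP: sn.
- rewrite -carc_compl; last by lia.
  apply/set0Pn; exists (shift s o); rewrite inE (eqP (_ : dist _ _ == 0)) ?dist_eq0 //; lia.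
- exact: restr_bases glue.
- apply: restr_bases => B B' M M'; rewrite setCK setUC; exact: glue.
apply/setP => B; apply/idP/imset2P => [MB|[_ _ /imsetP[B1 M1 ->] /imsetP[B2 M2 ->] ->]].
  exists (B :&: S) (B :&: ~: S); [| |by rewrite -setIUr setUCr setIT].
    by apply/imsetP; exists B.
  by apply/imsetP; exists B.
exact: glue.
Qed.

End Positroids.

(** * Cyclic descents *)

Lemma index_rot (T : eqType) (s : seq T) m x : uniq s -> x \in s -> m <= size s ->
  index x (rot m s) = if index x s < m then size s - m + index x s else index x s - m.
Proof.
move=> us xs ms; rewrite /rot index_cat size_drop.
have xE := nth_index x xs; have xn : index x s < size s by rewrite index_mem.
case: ltnP => h.
  have xt : x \in take m s.
    by rewrite -[x in x \in _]xE -(nth_take _ h) mem_nth // size_takel.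
  have xd : x \notin drop m s.
    have := us; rewrite -{1}(cat_take_drop m s) cat_uniq => /and3P[_ /hasPn hd _].
    by apply/negP => /hd /=; rewrite xt.
  rewrite (negbTE xd); congr (_ + _).
  by rewrite -[in RHS](cat_take_drop m s) index_cat xt.
have xd : x \in drop m s.
  rewrite -[x in x \in _]xE -[index x s](subnKC h) -nth_drop mem_nth // size_drop.
  by rewrite ltn_sub2r // (leq_ltn_trans h).
rewrite xd -[in RHS](cat_take_drop m s) index_cat size_takel //.
have xt : x \notin take m s.
  have := us; rewrite -{1}(cat_take_drop m s) cat_uniq => /and3P[_ /hasPn hd _].
  exact: (hd _ xd).
by rewrite (negbTE xt) addKn.
Qed.

Lemma index_filter_lt (T : eqType) (p : pred T) (s : seq T) x y :
  p x -> p y -> x \in s ->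
  (index x (filter p s) < index y (filter p s)) = (index x s < index y s).
Proof.
move=> px py; elim: s => [//|z s IH]; rewrite in_cons /=.
case: (z =P x) => [->|zx] /=; first by rewrite px /= eqxx; case: eqP.
rewrite eq_sym (negbTE (introN eqP zx)) /= => /IH IHx.
case: (z =P y) => [->|zy] /=; first by rewrite py /= eqxx.
case: ifP => //= _; rewrite (negbTE (introN eqP zx)) (negbTE (introN eqP zy)) ltnS.
by rewrite IHx.
Qed.

Section Words.
Variable n : nat.
Implicit Types (w : 'S_n) (i a x r : 'I_n) (d : nat).

Definition pos w x : nat := index x (one_line w).

Lemma one_line_uniq w : uniq (one_line w).
Proof. by rewrite map_inj_uniq ?enum_uniq //; exact: perm_inj. Qed.

Lemma size_one_line w : size (one_line w) = n.
Proof. by rewrite size_map size_enum_ord. Qed.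

Lemma posE w x : pos w x = (w^-1)%g x.
Proof.
rewrite /pos -{1}(permKV w x) index_map; last exact: perm_inj.
exact: index_enum_ord.
Qed.

Lemma mem_one_line w x : x \in one_line w.
Proof. by rewrite -(permKV w x) map_f // mem_enum. Qed.

Lemma pos_perm w (p : 'I_n) : pos w (w p) = p.
Proof. by rewrite posE permK. Qed.

Lemma pos_inj w : injective (pos w).
Proof. by move=> x y; rewrite !posE => /ord_inj /perm_inj. Qed.

Lemma pos_lt w x : pos w x < n.
Proof. by rewrite posE. Qed.

Lemma next_traject i d x : d < n -> dist i x <= d ->
  next (traject (@ordS n) i d.+1) x = if dist i x < d then ordS x else i.
Proof.
move=> dn xd; have ut : uniq (traject (@ordS n) i d.+1).
  by rewrite -(take_traject _ _ dn) take_uniq // -cyc_enumE cyc_enum_uniq.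
have xE : x = nth i (traject (@ordS n) i d.+1) (dist i x).
  by rewrite nth_traject // -/(shift _ _) shift_dist.
have xi : index x (traject (@ordS n) i d.+1) = dist i x.
  by rewrite {1}xE index_uniq // size_traject.
rewrite next_nth {1}xE mem_nth ?size_traject // xi /=.
case: ltnP => h; last by rewrite nth_default // size_traject.
rewrite (set_nth_default (ordS i)) ?size_traject // nth_traject // -iterSr /=.
by rewrite -/(shift _ _) shift_dist.
Qed.

Lemma next_enum x : next (enum 'I_n) x = ordS x.
Proof.
have n0 : 0 < n := leq_ltn_trans (leq0n _) (ltn_ord x).
pose o := Ordinal n0.
have -> : enum 'I_n = traject (@ordS n) o n.-1.+1.
  by rewrite prednK // -cyc_enumE /cyc_enum /= rot0.
have xn := dist_lt o x; rewrite next_traject; try lia.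
case: ltnP => // h; rewrite -[x in ordS x](shift_dist o).
have -> : dist o x = n.-1 by lia.
by rewrite -shiftS prednK // shiftn.
Qed.

Lemma mem_cyc_interval i a x : (x \in cyc_interval i a) = (dist i x <= dist i a).
Proof. by rewrite mem_filter mem_cyc_enum andbT. Qed.

Lemma cyc_intervalE i a : cyc_interval i a = traject (@ordS n) i (dist i a).+1.
Proof.
have an := dist_lt i a.
rewrite -(take_traject _ _ an) -cyc_enumE /cyc_interval.
rewrite -[in LHS](cat_take_drop (dist i a).+1 (cyc_enum i)) filter_cat.
have se : size (cyc_enum i) = n by rewrite size_rot size_enum_ord.
have dn d : d < n -> dist i (nth i (cyc_enum i) d) = d.
  by move=> dn; rewrite /dist index_uniq ?cyc_enum_uniq ?se.
have /eqP -> : [seq x <- drop (dist i a).+1 (cyc_enum i) | cyc_le i x a] == [::].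
  rewrite -size_eq0 size_filter -leqn0 leqNgt -has_count; apply/hasPn => x /(nthP i)[d].
  rewrite size_drop se => hd <-; rewrite nth_drop /cyc_le -!/(dist _ _) dn; lia.
rewrite cats0; apply/all_filterP/(all_nthP i) => d; rewrite size_takel ?se // => hd.
by rewrite nth_take // /cyc_le -!/(dist _ _) dn //; lia.
Qed.

(** This is $I_r(w)$ for the last letter r of [w]; the sets for the other letters are compared with
    it. *)
Definition cdes0 w : {set 'I_n} := cDesL (enum 'I_n) (one_line w).

Lemma mem_cdes0 w x : (x \in cdes0 w) = (pos w (ordS x) < pos w x).
Proof. by rewrite inE mem_enum next_enum. Qed.

(** The rotation moves the letters up to [r] to the end, so the relative order of [x] and its
    successor flips exactly when the cut after [r] separates them. The additive form telescopes
    along arcs. *)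
Lemma mem_I_ w r x :
  (x \in I_ w r) + (pos w (ordS x) <= pos w r) = (x \in cdes0 w) + (pos w x <= pos w r).
Proof.
rewrite mem_cdes0 inE mem_enum next_enum /rot_to -/(pos w r).
have rn := pos_lt w r; rewrite !index_rot ?one_line_uniq ?mem_one_line ?size_one_line //.
rewrite -!/(pos w _) !ltnS; have := pos_lt w x; have := pos_lt w (ordS x).
case: (leqP (pos w (ordS x)) (pos w r)); case: (leqP (pos w x) (pos w r)) => /=; lia.
Qed.

Lemma card_carc_telescope (A B : {set 'I_n}) (g : 'I_n -> nat) i d : d <= n ->
  (forall x, (x \in A) + g (ordS x) = (x \in B) + g x) ->
  #|A :&: carc i d| + g (shift d i) = #|B :&: carc i d| + g i.
Proof.
move=> dn h; elim: d dn => [|d IH] dn; first by rewrite carc0 !setI0.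
rewrite !card_carcS // shiftS; have := IH (ltnW dn); have := h (shift d i); lia.
Qed.

(** After telescoping, the count depends on [r] only through the sides of the cut on which the two
    ends of the arc fall. *)
Lemma card_I_carc w r i d : d <= n ->
  #|I_ w r :&: carc i d| + (pos w (shift d i) <= pos w r) =
  #|cdes0 w :&: carc i d| + (pos w i <= pos w r).
Proof.
move=> dn; apply: (card_carc_telescope i dn (g := fun x => nat_of_bool (pos w x <= pos w r))).
by move=> x; exact: mem_I_.
Qed.

Lemma card_I_ w r : #|I_ w r| = #|cdes0 w|.
Proof.
have := card_I_carc w r r (leqnn n).
by rewrite shiftn carcT // !setIT => /eqP; rewrite eqn_add2r => /eqP.
Qed.

(** Inside the interval successors are the same as on the whole circle, except for the maximum [a],
    whose successor becomes [i]; this is the extra term. *)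
Lemma cdesL_restr w i a :
  cdesL (cyc_interval i a) (restr w i a) =
  #|cdes0 w :&: carc i (dist i a)| + (pos w i < pos w a).
Proof.
rewrite /cdesL (cardsD1 a) addnC; congr (_ + _).
  apply: eq_card => x; rewrite !inE mem_cyc_interval.
  rewrite mem_enum /= next_enum -!/(pos w _).
  case: (ltnP (dist i x) (dist i a)) => h; last first.
    rewrite andbF; apply/negbTE/negP => /and3P[xa h2 _]; move: xa.
    by rewrite -(inj_eq (@dist_inj _ i)); lia.
  have -> : x != a by rewrite -(inj_eq (@dist_inj _ i)); lia.
  rewrite ltnW //= andbT cyc_intervalE next_traject ?dist_lt ?(ltnW h) // h.
  rewrite /restr index_filter_lt ?mem_one_line ?mem_cyc_interval ?(ltnW h) //.
  by rewrite -(shift_dist i x) -shiftS dist_shift // (leq_ltn_trans h) ?dist_lt.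
rewrite inE mem_cyc_interval leqnn /= cyc_intervalE next_traject ?dist_lt // ltnn.
rewrite /restr index_filter_lt ?mem_one_line ?mem_cyc_interval //.
by rewrite (eqP (_ : dist i i == 0)) ?dist_eq0.
Qed.

(* The word cut after i puts i last, so among the sets I_r the maximum of the
   number of elements in [i, a) is attained at r = i, where it is the number of
   cyclic descents of the subword on [i, a]. *)
Lemma card_I_carc_max w i a :
  #|I_ w i :&: carc i (dist i a)| = cdesL (cyc_interval i a) (restr w i a).
Proof.
rewrite cdesL_restr; have := @card_I_carc w i i (dist i a) (ltnW (dist_lt i a)).
rewrite shift_dist leqnn ltnNge; case: leqP => /=; lia.
Qed.

Lemma card_I_carc_le w r i a :
  #|I_ w r :&: carc i (dist i a)| <= cdesL (cyc_interval i a) (restr w i a).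
Proof.
rewrite cdesL_restr; have := @card_I_carc w r i (dist i a) (ltnW (dist_lt i a)).
rewrite shift_dist; case: leqP; case: leqP => /=; lia.
Qed.

Lemma cdesL_restr_le w r i a :
  cdesL (cyc_interval i a) (restr w i a) <= #|I_ w r :&: carc i (dist i a)|.+1.
Proof.
rewrite cdesL_restr; have := @card_I_carc w r i (dist i a) (ltnW (dist_lt i a)).
rewrite shift_dist; case: leqP; case: leqP; case: leqP => /=; lia.
Qed.

(** The Gale condition need only be tested on the arcs $[i, a^i_j)$, where [J i] has [j] elements
    ([j] counted from 0). The largest count of the sets $I_r$ there is the number of cyclic descents
    of the subword, so one bound on [w] covers all r. *)
Lemma Dset_gale k (J : 'I_n -> {set 'I_n}) : (forall i, #|J i| = k) ->
  Dset k J = [set w in Eset n k | [forall r : 'I_n, forall j : 'I_n,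
                                    gale_le j (J j) (I_ w r)]].
Proof.
move=> Jk; apply/setP => w; rewrite [LHS]in_set [RHS]in_set; case: (boolP (w \in Eset n k)) => //=.
rewrite in_set => /andP[_ /eqP wk].
have Ik r : #|I_ w r| = k by rewrite card_I_.
apply/forallP/forallP => [h r|h i].
  apply/forallP => i; apply: gale_le_nth => [|j]; first by rewrite Jk Ik.
  rewrite Jk => jk; apply: leq_trans (card_I_carc_le _ _ _ _) _.
  exact: (forallP (h i) (Ordinal jk)).
apply/forallP => j; rewrite -card_I_carc_max.
have /forallP/(_ i) := h i; move/(gale_le_carc (dist i (a_ J i j))) => /leq_trans; apply.
by rewrite card_carc_nth ?Jk.
Qed.

End Words.

From mathcomp Require Import boolp classical_sets cardinality reals.
From mathcomp Require Import lra ring.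
Import Order.TTheory GRing.Theory Num.Theory.

(** * Convex hulls *)

Section ConvexHull.
Local Open Scope ring_scope.
Variables (R : realType) (n : nat).
Implicit Types (I : finType) (x y : 'rV[R]_n).

Lemma conv_hull_vertex I (A : {set I}) (v : I -> 'rV[R]_n) i :
  i \in A -> conv_hull A v (v i).
Proof.
move=> iA; exists (fun j => (j == i)%:R); split => [j _||]; first exact: ler0n.
  rewrite (bigD1 i) //= eqxx big1 ?addr0 // => j /andP[_ /negbTE ->] //.
rewrite (bigD1 i) //= eqxx scale1r big1 ?addr0 // => j /andP[_ /negbTE ->].
by rewrite scale0r.
Qed.

Lemma conv_hull_convex I (A : {set I}) (v : I -> 'rV[R]_n) x y t :
  0 <= t <= 1 -> conv_hull A v x -> conv_hull A v y ->
  conv_hull A v ((1 - t) *: x + t *: y).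
Proof.
move=> /andP[t0 t1] [c [c0 c1 ->]] [d [d0 d1 ->]].
exists (fun i => (1 - t) * c i + t * d i); split.
- by move=> i iA; rewrite addr_ge0 // mulr_ge0 ?subr_ge0 ?c0 ?d0.
- by rewrite big_split -!mulr_sumr /= c1 d1; ring.
by rewrite !scaler_sumr -big_split /=; apply: eq_bigr => i _; rewrite [RHS]scalerDl !scalerA.
Qed.

Lemma conv_hull_subset I1 I2 (A1 : {set I1}) (A2 : {set I2})
    (v1 : I1 -> 'rV[R]_n) (v2 : I2 -> 'rV[R]_n) :
  (forall i, i \in A1 -> exists2 j, j \in A2 & v1 i = v2 j) ->
  (conv_hull A1 v1 `<=` conv_hull A2 v2)%classic.
Proof.
move=> h x [c [c0 c1 ->]].
have [A10|[i0 i0A]] := set_0Vmem A1; first by move: c1; rewrite A10 big_set0; lra.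
(* [j0] is only a default value making [f] total; weights are then pushed forward along [f]. *)
have [j0 _ _] := h _ i0A.
pose f i := odflt j0 [pick j in A2 | v1 i == v2 j].
have fP i : i \in A1 -> f i \in A2 /\ v1 i = v2 (f i).
  move=> /h[j jA vE]; rewrite /f; case: pickP => [j' /andP[-> /eqP ->] //|/(_ j)].
  by rewrite jA vE eqxx.
exists (fun j => \sum_(i in A1 | f i == j) c i); split.
- by move=> j _; apply: sumr_ge0 => i /andP[/c0].
- by rewrite -c1 (partition_big f (mem A2)) // => i /fP[].
rewrite (partition_big f (mem A2)) => [|i /fP[]] //=; apply: eq_bigr => j _.
by rewrite scaler_suml; apply: eq_bigr => i /andP[/fP[_ ->] /eqP ->].
Qed.

(* If v i = \sum c_j v'_j and each v'_j is a combination of the v's, then affine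
   independence forces every v'_j with c_j > 0 to be v i. *)
Lemma simplex_vertex (m : nat) I (v : 'I_m -> 'rV[R]_n) (A : {set I}) (v' : I -> 'rV[R]_n) :
  affinely_independent v -> conv_hull [set: 'I_m]%SET v = conv_hull A v' ->
  forall i, exists2 j, j \in A & v i = v' j.
Proof.
move=> ai eqS i.
have : conv_hull A v' (v i) by rewrite -eqS; apply: conv_hull_vertex; rewrite inE.
move=> [c [c0 c1 vE]].
have ex_d j : exists d : 'I_m -> R, j \in A ->
    [/\ forall l, 0 <= d l, \sum_l d l = 1 & v' j = \sum_l d l *: v l].
  have [jA|_] := boolP (j \in A); last by exists (fun=> 0).
  have : conv_hull [set: 'I_m]%SET v (v' j) by rewrite eqS; exact: conv_hull_vertex.
  move=> [d [d0 d1 dE]]; exists d => _; split.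
  - by move=> l; apply: d0; rewrite inE.
  - by rewrite -d1; apply: eq_bigl => l; rewrite inE.
  - by rewrite dE; apply: eq_bigl => l; rewrite inE.
have [d hd] := choice ex_d.
have [j jA cj] : exists2 j, j \in A & 0 < c j.
  apply: contrapT => no; suff : \sum_(i in A) c i = 0 by rewrite c1; lra.
  apply: big1 => j jA; apply/eqP; rewrite eq_le c0 // andbT leNgt.
  by apply/negP => cj; apply: no; exists j.
exists j => //; have [dj0 dj1 ->] := hd _ jA.
have e l : \sum_(j in A) c j * d j l - (l == i)%:R = 0.
  move: l; apply: ai.
    rewrite sumrB exchange_big /= (bigD1 i) //= eqxx [\sum_(_ | _ != _) _]big1 => [|l /negbTE -> //].
    rewrite addr0 (eq_bigr c) ?c1 ?subrr // => j' j'A.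
    by rewrite -mulr_sumr; have [_ -> _] := hd _ j'A; rewrite mulr1.
  under eq_bigr do rewrite scalerBl scaler_suml.
  rewrite sumrB exchange_big /= (bigD1 i) //= eqxx scale1r.
  rewrite [\sum_(_ | _ != _) _]big1 => [|l /negbTE ->]; last by rewrite scale0r.
  rewrite addr0 vE; apply/eqP; rewrite subr_eq0; apply/eqP/eq_bigr => j' j'A.
  have [_ _ ->] := hd _ j'A; rewrite scaler_sumr; apply: eq_bigr => l _.
  by rewrite scalerA.
have dz l : l != i -> d j l = 0.
  move=> li; have /eqP := e l; rewrite (negbTE li) subr0 psumr_eq0 => [/allP /(_ j)|j' j'A].
    by rewrite mem_index_enum jA mulf_eq0 gt_eqF //= => /(_ isT)/eqP.
  by rewrite mulr_ge0 ?c0 //; have [-> _ _] := hd _ j'A.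
have di : d j i = 1.
  by rewrite -dj1 (bigD1 i) //= big1 ?addr0.
rewrite (bigD1 i) //= di scale1r big1 ?addr0 // => l li.
by rewrite dz // scale0r.
Qed.

Definition coord_sum (S : {set 'I_n}) x : R := \sum_(l in S) x 0 l.

Lemma coord_sum_lin I (A : {pred I}) (c : I -> R) (v : I -> 'rV[R]_n) S :
  coord_sum S (\sum_(i in A) c i *: v i) = \sum_(i in A) c i * coord_sum S (v i).
Proof.
rewrite /coord_sum (eq_bigr (fun l => \sum_(i in A) c i * v i 0 l)).
  by rewrite exchange_big; apply: eq_bigr => i _; rewrite mulr_sumr.
by move=> l _; rewrite summxE; apply: eq_bigr => i _; rewrite mxE.
Qed.

Lemma coord_sumD S x y t :
  coord_sum S ((1 - t) *: x + t *: y) = (1 - t) * coord_sum S x + t * coord_sum S y.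
Proof.
rewrite /coord_sum !mulr_sumr -big_split; apply: eq_bigr => l _.
by rewrite !mxE.
Qed.

Lemma coord_sum_evec S (B : {set 'I_n}) : coord_sum S (evec R B) = #|B :&: S|%:R.
Proof.
rewrite /coord_sum -sum1_card natr_sum (eq_bigl (fun l => (l \in S) && (l \in B))).
  by rewrite big_mkcondr; apply: eq_bigr => l _; rewrite mxE; case: ifP.
by move=> l; rewrite inE andbC.
Qed.

Lemma evec_inj : injective (@evec R n).
Proof.
move=> A B /rowP h; apply/setP => l; have := h l; rewrite !mxE.
by case: (l \in A); case: (l \in B) => //= /eqP; rewrite ?oner_eq0 // eq_sym oner_eq0.
Qed.

(** Each coordinate of a 0/1 vector is extreme in [0, 1], so every point carrying positive weight
    must agree with it in every coordinate. *)
Lemma evec_conv_hull I (A : {set I}) (F : I -> {set 'I_n}) B :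
  conv_hull A (fun i => evec R (F i)) (evec R B) -> exists2 j, j \in A & F j = B.
Proof.
move=> [c [c0 c1 cE]].
have [j jA cj] : exists2 j, j \in A & 0 < c j.
  apply: contrapT => no; suff : \sum_(i in A) c i = 0 by rewrite c1; lra.
  apply: big1 => j jA; apply/eqP; rewrite eq_le c0 // andbT leNgt.
  by apply/negP => cj; apply: no; exists j.
exists j => //; apply/setP => l; have /rowP/(_ l) := cE; rewrite summxE mxE => e.
have e' : \sum_(i in A) c i * ((l \in F i)%:R - (l \in B)%:R) = 0.
  rewrite (eq_bigr (fun i => c i * (l \in F i)%:R - c i * (l \in B)%:R)); last first.
    by move=> i _; rewrite mulrBr.
  rewrite sumrB -mulr_suml c1 mul1r e; apply/eqP; rewrite subr_eq0; apply/eqP/eq_bigr => i _.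
  by rewrite !mxE.
have [lB|lB] := boolP (l \in B); rewrite ?lB ?(negbTE lB) in e'.
  have : \sum_(i in A) c i * (1 - (l \in F i)%:R) = 0.
    by rewrite -[RHS]oppr0 -[in RHS]e' -sumrN; apply: eq_bigr => i _; rewrite -mulrN opprB.
  move/eqP; rewrite psumr_eq0 => [/allP/(_ j)|i iA].
    rewrite mem_index_enum jA mulf_eq0 gt_eqF //= => /(_ isT).
    by case: (l \in F j); rewrite // subr0 oner_eq0.
  by rewrite mulr_ge0 ?c0 // subr_ge0 lern1 leq_b1.
move/eqP: e'; rewrite psumr_eq0 => [/allP/(_ j)|i iA].
  rewrite mem_index_enum jA mulf_eq0 gt_eqF //= => /(_ isT).
  by case: (l \in F j); rewrite // subr0 oner_eq0.
by rewrite mulr_ge0 ?c0 // subr0.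
Qed.

End ConvexHull.

(** * Height functions *)

Section Tails.
Local Open Scope ring_scope.
Variables (n : nat) (V : zmodType).
Implicit Types (i : 'I_n).

Lemma ordS_invariant (T : Type) (h : 'I_n -> T) :
  (forall i, h (ordS i) = h i) -> forall i j, h i = h j.
Proof.
move=> hS i j; rewrite -(shift_dist i j); move: (dist i j).
by elim=> [//|d IH]; rewrite shiftS hS.
Qed.

Lemma sum_ordS_diff (g : 'I_n -> V) : \sum_i (g i - g (ordS i)) = 0.
Proof. by rewrite sumrB [X in X - _](reindex_inj (@ordS_inj n)) /= subrr. Qed.

(** A discrete antiderivative of [f] around the circle; crossing from the last index to the first
    costs the total sum. *)
Definition tail (f : 'I_n -> V) i : V := \sum_(l : 'I_n | (i <= l)%N) f l.

Lemma tail_ordS f i :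
  tail f i - tail f (ordS i) = f i - (if i.+1 == n then \sum_l f l else 0).
Proof.
rewrite /tail (bigD1 i) //=; case: eqP => hi.
  rewrite [X in _ + X - _]big1 ?addr0 => [|l /andP[il li]].
    congr (_ - _); apply: eq_bigl => l; rewrite hi modnn //.
  by case/negP: li; apply/eqP/ord_inj; have := ltn_ord l; lia.
have -> : \sum_(l : 'I_n | (i <= l)%N && (l != i)) f l = \sum_(l : 'I_n | (ordS i <= l)%N) f l.
  apply: eq_bigl => l; rewrite /= modn_small; last by have := ltn_ord i; lia.
  by rewrite ltn_neqAle andbC eq_sym.
by rewrite addrK subr0.
Qed.

Lemma tail_eq f (g : 'I_n -> V) i j : (forall i, f i = g i - g (ordS i)) ->
  tail f i - tail f j = g i - g j.
Proof.
move=> fE; have f0 : \sum_l f l = 0 by rewrite (eq_bigr _ (fun i _ => fE i)) sum_ordS_diff.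
suff h : tail f i - g i = tail f j - g j.
  by apply/eqP; rewrite subr_eq addrAC -addrA -h addrC subrK.
move: i j; apply: (ordS_invariant (h := fun i => tail f i - g i)) => i.
have := tail_ordS f i; rewrite f0 if_same subr0 fE => /eqP.
rewrite subr_eq => /eqP ->.
by rewrite [RHS]addrAC [_ - g i]addrAC subrr sub0r addrC.
Qed.

End Tails.

Section Heights.
Local Open Scope ring_scope.
Variables (R : realType) (n : nat).
Implicit Types (w : 'S_n) (x : 'rV[R]_n) (G c : 'I_n -> R) (a b i r : 'I_n).

Definition next_letter w r := w (ordS ((w^-1)%g r)).
Definition is_last w r : bool := (pos w r).+1 == n.

(** On the circle cut open at the end of [w], with gap [c r] after each letter [r], this is the
    distance from [i] to the end. *)
Definition height w c i : R := \sum_(r | (pos w i <= pos w r)%N) c r.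

Lemma height_tail w c i : height w c i = tail (fun p => c (w p)) ((w^-1)%g i).
Proof.
rewrite /height /tail (reindex_inj (@perm_inj _ w)); apply: eq_bigl => p.
by rewrite pos_perm posE.
Qed.

Lemma height_next w c r :
  height w c r - height w c (next_letter w r) =
  c r - (if is_last w r then \sum_i c i else 0).
Proof.
rewrite !height_tail /next_letter permK tail_ordS permKV /is_last posE.
by rewrite [in RHS](reindex_inj (@perm_inj _ w)).
Qed.

Lemma next_letter_invariant w (T : Type) (h : 'I_n -> T) :
  (forall r, h (next_letter w r) = h r) -> forall i j, h i = h j.
Proof.
move=> hN i j; rewrite -(permKV w i) -(permKV w j).
by apply: (ordS_invariant (h := h \o w)) => p /=; rewrite -[RHS]hN /next_letter permK.
Qed.

Lemma pos_next w r : ~~ is_last w r -> pos w (next_letter w r) = (pos w r).+1.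
Proof.
rewrite /is_last /next_letter pos_perm /= posE => h; rewrite modn_small //.
by have := ltn_ord ((w^-1)%g r); lia.
Qed.

Lemma pos_next_last w r : is_last w r -> pos w (next_letter w r) = 0%N.
Proof. by rewrite /is_last /next_letter pos_perm /= posE => /eqP ->; rewrite modnn. Qed.

Lemma mem_I_R w r i :
  (i \in I_ w r)%:R = (i \in cdes0 w)%:R + (pos w i <= pos w r)%:R
                      - (pos w (ordS i) <= pos w r)%:R :> R.
Proof. by apply/eqP; rewrite eq_sym subr_eq eq_sym -!natrD mem_I_. Qed.

(** Averaging [mem_I_] with the weights [c] turns prefix indicators into heights. Coordinate [i] is
    thus the step from [i] to its successor, with a full turn added at the descents. *)
Lemma height_coord w c i :
  (\sum_r c r *: evec R (I_ w r)) 0 i =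
  (\sum_r c r) * (i \in cdes0 w)%:R + height w c i - height w c (ordS i).
Proof.
rewrite summxE (eq_bigr (fun r => c r * (i \in cdes0 w)%:R +
  (if (pos w i <= pos w r)%N then c r else 0) -
  (if (pos w (ordS i) <= pos w r)%N then c r else 0))); last first.
  move=> r _; rewrite !mxE mem_I_R mulrBr mulrDr.
  by case: ifP; case: ifP; rewrite ?mulr1 ?mulr0.
by rewrite sumrB big_split /= -mulr_suml -!big_mkcond.
Qed.

Lemma height_first w c i : pos w i = 0%N -> height w c i = \sum_r c r.
Proof. by move=> i0; apply: eq_bigl => r; rewrite i0. Qed.

Lemma first_letter w i : exists2 a, pos w a = 0%N & forall b, (pos w a <= pos w b)%N.
Proof.
have n0 : (0 < n)%N := leq_ltn_trans (leq0n _) (ltn_ord i).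
by exists (w (Ordinal n0)) => [|b]; rewrite pos_perm.
Qed.

(** A vanishing combination makes the heights invariant under [ordS], hence constant, and the
    weights are the drops of height along [w]. *)
Lemma Delta_affinely_independent w c :
  \sum_r c r = 0 -> \sum_r c r *: evec R (I_ w r) = 0 -> forall r, c r = 0.
Proof.
move=> c0 cE.
have hS i : height w c (ordS i) = height w c i.
  have := height_coord w c i; rewrite cE c0 mul0r mxE add0r => /esym/eqP.
  by rewrite subr_eq0 => /eqP.
move=> r; have := height_next w c r.
by rewrite c0 if_same subr0 (ordS_invariant hS _ r) subrr.
Qed.

(** The inverse of [height]: gaps recovered from heights. The 1 closes the circle, of length one,
    after the last letter. *)
Definition coef w G r : R :=
  G r - G (next_letter w r) + (if is_last w r then 1 else 0).

Lemma sum_coef w G (i : 'I_n) : \sum_r coef w G r = 1.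
Proof.
rewrite big_split /= (reindex_inj (@perm_inj _ w)) /=.
rewrite (eq_bigr (fun p => G (w p) - G (w (ordS p)))); last first.
  by move=> p _; rewrite /next_letter permK.
rewrite (sum_ordS_diff (fun p => G (w p))) add0r.
have n0 : (0 < n)%N := leq_ltn_trans (leq0n _) (ltn_ord i).
have hl : (n.-1 < n)%N by rewrite prednK.
rewrite (bigD1 (w (Ordinal hl))) //= big1 ?addr0 => [|r rl].
  by rewrite /is_last pos_perm /= prednK // eqxx.
case: ifP => // /eqP h; case/negP: rl; rewrite -(inj_eq (@pos_inj _ w)) pos_perm /=; lia.
Qed.

(** [G] and the heights built from its gaps have the same drops along [w], so they differ by a
    constant, which cancels in [height_coord]. *)
Lemma coef_barycenter w G x :
  (forall i, x 0 i = (i \in cdes0 w)%:R + G i - G (ordS i)) ->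
  x = \sum_r coef w G r *: evec R (I_ w r).
Proof.
move=> xE; have h : forall i j, height w (coef w G) i - G i = height w (coef w G) j - G j.
  apply: (next_letter_invariant (w := w) (h := fun i => height w (coef w G) i - G i)) => r.
  have := height_next w (coef w G) r; rewrite (sum_coef w G r) [coef w G r]/coef.
  by case: ifP; lra.
apply/rowP => i; rewrite height_coord sum_coef // mul1r xE.
by have := h i (ordS i); lra.
Qed.

(** The letters fit in this order within one turn; this makes all gaps [coef w G] nonnegative. *)
Definition heights w G : Prop :=
  forall a b, (pos w a <= pos w b)%N -> G b <= G a <= G b + 1.

Lemma coef_ge0 w G r : heights w G -> 0 <= coef w G r.
Proof.
move=> hG; rewrite /coef; case: (boolP (is_last w r)) => hr.
  have [] := andP (hG (next_letter w r) r _); first by rewrite pos_next_last.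
  lra.
have [] := andP (hG r (next_letter w r) _); first by rewrite pos_next.
lra.
Qed.

Lemma heights_height w c : (forall r, 0 <= c r) -> \sum_r c r = 1 -> heights w (height w c).
Proof.
move=> c0 c1 a b ab.
have pos0 i : 0 <= height w c i by apply: sumr_ge0.
have le1 i : height w c i <= 1.
  by rewrite -c1 /height [leRHS](bigID (fun r => (pos w i <= pos w r)%N)) /= lerDl sumr_ge0.
rewrite (le_trans (le1 a)) ?lerDr // andbT /height.
rewrite [leRHS](bigID (fun r => (pos w b <= pos w r)%N)) /=.
rewrite (eq_bigl (fun r => (pos w a <= pos w r)%N && (pos w b <= pos w r)%N)); last first.
  by move=> r; case: (leqP (pos w b)) => h; rewrite ?andbF // (leq_trans ab h).
by rewrite lerDl sumr_ge0.
Qed.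

Lemma DeltaP w x :
  Delta R w x <-> exists c : 'I_n -> R,
    [/\ forall r, 0 <= c r, \sum_r c r = 1 & x = \sum_r c r *: evec R (I_ w r)].
Proof.
have e (V : nmodType) (F : 'I_n -> V) : \sum_(i in [set: 'I_n]%SET) F i = \sum_i F i.
  by apply: eq_bigl => i; rewrite inE.
split=> -[c [c0 c1 xE]]; exists c; split; rewrite ?e //; rewrite ?e in c1 xE => //.
by move=> r; apply: c0; rewrite inE.
Qed.

Lemma Delta_heights w x (i0 : 'I_n) :
  Delta R w x <-> exists2 G, heights w G &
    forall i, x 0 i = (i \in cdes0 w)%:R + G i - G (ordS i).
Proof.
rewrite DeltaP; split=> [[c [c0 c1 ->]]|[G hG xE]].
  by exists (height w c); [exact: heights_height | move=> i; rewrite height_coord c1 mul1r].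
exists (coef w G); split; [by move=> r; exact: coef_ge0|exact: sum_coef|exact: coef_barycenter].
Qed.

Definition offset w x i : R := x 0 i - (i \in cdes0 w)%:R.

(** The height function is determined by [x] up to a constant, so [tail (offset w x)] may be taken.
    Membership becomes a system of weak inequalities affine in [x], which can pass to a limit. *)
Lemma Delta_tail w x (i0 : 'I_n) :
  Delta R w x <-> \sum_i x 0 i = #|cdes0 w|%:R /\ heights w (tail (offset w x)).
Proof.
have sE : \sum_i offset w x i = \sum_i x 0 i - #|cdes0 w|%:R.
  rewrite sumrB -sum1_card natr_sum [X in _ = _ - X]big_mkcond; congr (_ - _).
  by apply: eq_bigr => i _; case: (i \in cdes0 w).
rewrite (Delta_heights w x i0); split=> [[G hG xE]|[xk hT]].
  have oE i : offset w x i = G i - G (ordS i) by rewrite /offset xE; ring.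
  split.
    by apply/eqP; rewrite -subr_eq0 -sE (eq_bigr (fun i => G i - G (ordS i))) ?sum_ordS_diff.
  move=> a b /hG; have := tail_eq a b oE; lra.
exists (tail (offset w x)) => // i.
have := tail_ordS (offset w x) i; rewrite sE xk subrr if_same /offset; lra.
Qed.

End Heights.

(** * Simplices through a common point *)

Section Support.
Local Open Scope ring_scope.
Variables (R : realType) (n : nat).
Implicit Types (w : 'S_n) (x : 'rV[R]_n) (G c : 'I_n -> R) (a b i r : 'I_n).

Lemma int_lt1_eq0 (z : R) : z \is a Num.int -> -1 < z < 1 -> z = 0.
Proof.
move=> zi z1; apply/eqP; apply: contraT => z0.
have := norm_intr_ge1 zi z0; rewrite leNgt ltr_norml z1 //.
Qed.

Lemma bool_int (b : bool) : (b%:R : R) \is a Num.int.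
Proof. by rewrite rpred_nat. Qed.

Lemma height_ge0 w c i : (forall r, 0 <= c r) -> 0 <= height w c i.
Proof. by move=> c0; apply: sumr_ge0. Qed.

Lemma height_le1 w c i : (forall r, 0 <= c r) -> \sum_r c r = 1 -> height w c i <= 1.
Proof.
move=> c0 c1; have [a a0 _] := first_letter w i.
rewrite -c1 -(height_first c a0); have := heights_height (w := w) c0 c1.
by move=> /(_ a i); rewrite a0 => /(_ isT)/andP[].
Qed.

Lemma height_last w c r : is_last w r -> height w c r = c r.
Proof.
move=> /eqP lr; rewrite /height (bigD1 r) //= big1 ?addr0 // => j /andP[rj jr].
case/negP: jr; rewrite -(inj_eq (@pos_inj _ w)); have := pos_lt w j; lia.
Qed.

(* With theta = height r, the letters up to r are those of height at least theta. *)
Lemma height_window w c r i : (forall r, 0 <= c r) -> \sum_r c r = 1 -> 0 < c r ->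
  (pos w i <= pos w r)%N%:R - 1 <= height w c i - height w c r < (pos w i <= pos w r)%N%:R.
Proof.
move=> c0 c1 cr; have hG := heights_height (w := w) c0 c1.
have gi0 := height_ge0 w i c0; have gi1 := height_le1 w i c0 c1.
have gr1 := height_le1 w r c0 c1.
have gr : c r <= height w c r by rewrite /height (bigD1 r) //= lerDl sumr_ge0.
case: (leqP (pos w i) (pos w r)) => [/hG|h] /=; first by lra.
have rl : ~~ is_last w r by rewrite /is_last; have := pos_lt w i; lia.
have /hG : (pos w (next_letter w r) <= pos w i)%N by rewrite pos_next.
have := height_next w c r; rewrite (negbTE rl); lra.
Qed.

(* The set I_r is recovered from the point x and the real number height r modulo
   1, independently of w. *)
Lemma Delta_support w w' c c' r :
  (forall r, 0 <= c r) -> \sum_r c r = 1 ->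
  (forall r, 0 <= c' r) -> \sum_r c' r = 1 ->
  \sum_r c r *: evec R (I_ w r) = \sum_r c' r *: evec R (I_ w' r) ->
  0 < c r -> exists2 r', 0 < c' r' & I_ w' r' = I_ w r.
Proof.
move=> c0 c1 c0' c1' eqx cr.
set G := height w c; set G' := height w' c'.
have xE i : (i \in cdes0 w)%:R + G i - G (ordS i) = (i \in cdes0 w')%:R + G' i - G' (ordS i).
  by have := height_coord w c i; rewrite eqx height_coord c1 c1' !mul1r => /esym.
pose h i := G i - G' i.
have hint i : h i - h r \is a Num.int.
  suff -> : (h i - h r \is a Num.int) = (h r - h r \is a Num.int) by rewrite subrr rpred0.
  apply: (ordS_invariant (h := fun i => h i - h r \is a Num.int)) => j.
  have -> : h (ordS j) - h r =
      ((j \in cdes0 w)%:R - (j \in cdes0 w')%:R) + (h j - h r).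
    by have := xE j; rewrite /h; lra.
  by rewrite rpredDl // rpredB ?bool_int.
(* [y] equals [G' r], and [t] is its representative modulo 1 in (0, 1]. The bound [t] at most 1
   guarantees a letter of height at least [t], namely the first one; positivity of [t] is used when
   the cut falls at the end of [w']. *)
pose y := G r - h r; pose m : R := (Num.ceil y - 1)%:~R; pose t := y - m.
have mi : m \is a Num.int by rewrite intr_int.
have t01 : 0 < t <= 1.
  by have := real_ceil_itv (num_real y); rewrite /t /m intrB mulr1z; lra.
have [a a0 ale] := first_letter w' r.
have Ga : t <= G' a by rewrite /G' height_first // c1'; lra.
(* [r'] is the last letter of [w'] whose height reaches [t]; what follows it lies below [t], so the
   gap after it is positive. *)
case: (arg_maxnP (P := fun i => t <= G' i) (pos w') Ga) => r' hr' rmax.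
have hG' := heights_height (w := w') c0' c1'.
have cut i : (pos w' i <= pos w' r')%N = (t <= G' i).
  apply/idP/idP => [/hG'/andP[+ _]|]; [exact: le_trans|exact: rmax].
have win' i : (pos w' i <= pos w' r')%N%:R - 1 <= G' i - t < (pos w' i <= pos w' r')%N%:R.
  have := height_ge0 w' i c0'; have := height_le1 w' i c0' c1'; rewrite -/G' cut.
  case: (leP t (G' i)) => /=; lra.
exists r'.
  have := height_next w' c' r'; case: (boolP (is_last w' r')) => lr.
    by move=> _; rewrite -(height_last c' lr) -/G'; lra.
  have : ~~ (pos w' (next_letter w' r') <= pos w' r')%N by rewrite pos_next // ltnn.
  rewrite cut -ltNge -/G'; lra.
apply: (@evec_inj R); apply/rowP => i; rewrite !mxE !mem_I_R.
(* The difference of the two sides is an integer, and the two windows of length one place it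
   strictly between -1 and 1. *)
have key j : (pos w' j <= pos w' r')%N%:R - (pos w j <= pos w r)%N%:R = m - (h j - h r).
  apply/eqP; rewrite -subr_eq0; apply/eqP/int_lt1_eq0.
    by apply: rpredB; apply: rpredB; rewrite ?bool_int ?hint.
  have := height_window w j c0 c1 cr; have := win' j; rewrite -/G /t /y /h; lra.
have := key i; have := key (ordS i); have := xE i; rewrite /h; lra.
Qed.

End Support.

(** * Small perturbations along segments *)

Section Perturbation.
Local Open Scope ring_scope.
Variable R : realType.
Implicit Types (u v t e : R).

Lemma uniform_eps (I : finType) (P : I -> R -> Prop) :
  (forall i, exists2 e0, 0 < e0 & forall e, 0 < e < e0 -> P i e) ->
  exists2 e0, 0 < e0 & forall e, 0 < e < e0 -> forall i, P i e.
Proof.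
move=> h; suff [e0 e00 he] : exists2 e0, 0 < e0 &
    forall e, 0 < e < e0 -> forall i, i \in enum I -> P i e.
  by exists e0 => // e /he hP i; apply: hP; rewrite mem_enum.
elim: (enum I) => [|i s [e1 e10 h1]]; first by exists 1.
have [e2 e20 h2] := h i; exists (Num.min e1 e2); first by rewrite lt_min e10.
move=> e; rewrite lt_min => /and3P[e0 l1 l2] j; rewrite inE => /predU1P[->|js].
  by apply: h2; rewrite e0.
by apply: h1; rewrite ?e0.
Qed.

Lemma segment_nonint u v : v != u \/ u \isn't a Num.int ->
  exists2 e0, 0 < e0 & forall e, 0 < e < e0 -> (1 - e) * u + e * v \isn't a Num.int.
Proof.
have up u1 v1 : u1 < v1 -> exists2 e0, 0 < e0 &
    forall e, 0 < e < e0 -> (1 - e) * u1 + e * v1 \isn't a Num.int.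
  move=> uv; have d0 : 0 < v1 - u1 by rewrite subr_gt0.
  have /andP[f1 f2] := real_floor_itv (num_real u1).
  (* This is the parameter at which the increasing affine function reaches the first integer above
     [u1]. *)
  exists (((Num.floor u1 + 1)%:~R - u1) / (v1 - u1)); first by rewrite divr_gt0 ?subr_gt0.
  move=> e /andP[e0]; rewrite ltr_pdivlMr // => e1.
  apply/negP => /intrP [z zE].
  have p : 0 < e * (v1 - u1) by rewrite mulr_gt0.
  have : (Num.floor u1)%:~R < z%:~R :> R by rewrite -zE; lra.
  have : z%:~R < (Num.floor u1 + 1)%:~R :> R by rewrite -zE; lra.
  by rewrite !ltr_int; lia.
case: (ltgtP u v) => [uv _|vu _|-> [|ui]]; first exact: up.
- have [|e0 e00 h] := up (- u) (- v); first by rewrite ltrN2.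
  exists e0 => // e /h; rewrite -rpredN; apply: contra.
  by have -> : - ((1 - e) * - u + e * - v) = (1 - e) * u + e * v by ring.
- by [].
exists 1 => // e _; apply: contra ui.
by have -> : (1 - e) * v + e * v = v by ring.
Qed.

Lemma segment_ge0 u v :
  (forall e0, 0 < e0 -> exists2 e, 0 < e < e0 & 0 <= (1 - e) * u + e * v) -> 0 <= u.
Proof.
move=> h; rewrite leNgt; apply/negP => u0.
have d0 : 0 < `|v - u| + 1 by rewrite ltr_wpDl.
(* For [u] negative the affine value is still negative below this bound; the added 1 keeps the
   denominator positive. *)
have [|e /andP[e0]] := h (- u / (`|v - u| + 1)); first by rewrite divr_gt0 // oppr_gt0.
rewrite ltr_pdivlMr // => e1; have := ler_norm (v - u).
rewrite -(ler_pM2l e0); lra.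
Qed.

End Perturbation.

(** * Covering the polytope *)

Section Covering.
Local Open Scope ring_scope.
Variables (R : realType) (n : nat).
Hypothesis n_gt1 : (1 < n)%N.
Implicit Types (w : 'S_n) (x y : 'rV[R]_n) (G c : 'I_n -> R) (a b i r : 'I_n).

Lemma sort_perm G : injective G ->
  exists w : 'S_n, forall a b, (pos w a <= pos w b)%N = (G b <= G a).
Proof.
move=> Ginj; pose rk a := #|[set b | G a < G b]%SET|.
have rkn a : (rk a < n)%N.
  rewrite -[X in (_ < X)%N](card_ord n) -cardsT; apply: proper_card.
  apply/properP; split; first exact: finset.subsetT.
  by exists a; rewrite !inE ?ltxx.
have rk_lt a b : G b < G a -> (rk a < rk b)%N.
  move=> ba; apply: proper_card; apply/properP; split.
    by apply/fintype.subsetP => z; rewrite !inE; exact: lt_trans.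
  by exists a; rewrite !inE ?ltxx.
have rk_le a b : (rk a <= rk b)%N = (G b <= G a).
  case: (ltgtP (G b) (G a)) => [/rk_lt/ltnW//|/rk_lt|/Ginj->]; last exact: leqnn.
  by rewrite ltnNge => /negbTE.
have rk_inj : injective (fun a => Ordinal (rkn a)).
  move=> a b /(congr1 val) /= e; apply: Ginj; apply/eqP.
  by rewrite eq_le -!rk_le e leqnn.
exists (perm rk_inj)^-1%g => a b.
by rewrite !posE invgK !permE /= rk_le.
Qed.

(** The type of [d] leaves out the whole circle, whose coordinate sum is the integer k on the
    polytope. *)
Definition generic x : Prop :=
  forall i (d : 'I_n), (0 < d)%N -> coord_sum (carc i d) x \isn't a Num.int.

Lemma generic_Delta x (k : nat) :
  (forall i, 0 <= x 0 i <= 1) -> \sum_i x 0 i = k%:R -> generic x ->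
  exists2 w : 'S_n, w \in Eset n k & exists c : 'I_n -> R,
    [/\ forall r, 0 < c r, \sum_r c r = 1 & x = \sum_r c r *: evec R (I_ w r)].
Proof.
move=> x01 xk gx; pose T := tail (fun l => x 0 l).
have hl : (n.-1 < n)%N by rewrite prednK // ltnW.
pose l := Ordinal hl.
have TS i : T i - T (ordS i) - x 0 i \is a Num.int.
  rewrite /T tail_ordS addrAC subrr sub0r rpredN.
  by case: ifP => _; rewrite ?rpred0 // xk rpred_nat.
have Tshift i d : (d <= n)%N -> T i - T (shift d i) - coord_sum (carc i d) x \is a Num.int.
  elim: d => [|d IH] dn; first by rewrite /coord_sum carc0 big_set0 !subrr rpred0.
  have -> : T i - T (shift d.+1 i) - coord_sum (carc i d.+1) x =
      (T i - T (shift d i) - coord_sum (carc i d) x)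
      + (T (shift d i) - T (ordS (shift d i)) - x 0 (shift d i)).
    rewrite /coord_sum carcS // big_setU1 ?shift_notin_carc // shiftS /=; ring.
  by apply: rpredD; [exact/IH/ltnW|exact: TS].
pose F (u : R) := u - (Num.floor u)%:~R.
have F01 u : 0 <= F u < 1.
  by have := real_floor_itv (num_real u); rewrite /F intrD mulr1z; lra.
have Fint u : F u - u \is a Num.int by rewrite /F addrAC subrr sub0r rpredN intr_int.
(* Positions on the circle are measured from the letter [l], which is n. It gets the least height 0,
   so sorting by decreasing height puts it last, as [Eset] requires. *)
pose G i := F (T i - T l).
have GT i j : (G i - G j) - (T i - T j) \is a Num.int.
  have -> : (G i - G j) - (T i - T j) = (G i - (T i - T l)) - (G j - (T j - T l)) by ring.
  by rewrite rpredB // Fint.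
have Ginj : injective G.
  move=> i j Gij; apply/eqP; apply: contraT => ij.
  have d0 : (0 < dist i j)%N by rewrite lt0n dist_eq0 eq_sym.
  have /negP[] := gx i (Ordinal (dist_lt i j)) d0.
  have -> : coord_sum (carc i (dist i j)) x =
     - (T i - T (shift (dist i j) i) - coord_sum (carc i (dist i j)) x) - ((G i - G j) - (T i - T j)).
    by rewrite shift_dist Gij; ring.
  by rewrite rpredB ?GT // rpredN Tshift // ltnW // dist_lt.
have Gl : G l = 0.
  by rewrite /G subrr /F floor0 subrr.
have [w wG] := sort_perm Ginj.
have ordS_neq i : ordS i != i.
  by rewrite -dist_eq0 -[ordS i]/(shift 1 i) dist_shift.
(* The two sides agree modulo 1. The descent term brings the right side strictly between 0 and 1,
   while [x 0 i] lies in [0, 1], so they are equal. *)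
have xE i : x 0 i = (i \in cdes0 w)%:R + G i - G (ordS i).
  apply/eqP; rewrite -subr_eq0; apply/eqP/int_lt1_eq0.
    have -> : x 0 i - ((i \in cdes0 w)%:R + G i - G (ordS i)) =
      - ((G i - G (ordS i)) - (T i - T (ordS i))) - (T i - T (ordS i) - x 0 i) - (i \in cdes0 w)%:R by ring.
    by apply: rpredB; [apply: rpredB; [rewrite rpredN; exact: GT|exact: TS]|exact: bool_int].
  have ne : G (ordS i) != G i by rewrite (inj_eq Ginj) ordS_neq.
  have := x01 i; have := F01 (T i - T l); have := F01 (T (ordS i) - T l).
  rewrite -!/(G _) mem_cdes0 ltnNge wG -ltNge.
  by move: ne; case: (ltgtP (G i) (G (ordS i))) => //= h _; lra.
have ck : #|cdes0 w| = k.
  apply/eqP; rewrite -(eqr_nat R) -xk -sum1_card natr_sum.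
  rewrite [X in X == _]big_mkcond /= -subr_eq0 -sumrB; apply/eqP.
  transitivity (- \sum_i (G i - G (ordS i))); last by rewrite sum_ordS_diff oppr0.
  rewrite -sumrN; apply: eq_bigr => i _.
  by rewrite xE; case: (i \in cdes0 w) => /=; ring.
exists w.
  rewrite inE /cdesL ck eqxx andbT; apply/forallP => p; apply/implyP => /eqP pn.
  have pl : p = l by apply: ord_inj => /=; lia.
  have G0 i : 0 <= G i by have /andP[] := F01 (T i - T l).
  have wl : G (w l) <= G l by rewrite -wG pos_perm /= -ltnS prednK ?pos_lt // ltnW.
  by rewrite pl; apply/eqP/Ginj/eqP; rewrite eq_le wl Gl G0.
exists (coef w G); split; [|exact: (sum_coef w G l)|exact: (coef_barycenter xE)].
move=> r; rewrite /coef; case: (boolP (is_last w r)) => hr.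
  have := F01 (T r - T l); have := F01 (T (next_letter w r) - T l).
  rewrite -!/(G _); lra.
have : ~~ (pos w (next_letter w r) <= pos w r)%N by rewrite pos_next // ltnn.
rewrite wG -ltNge; lra.
Qed.

End Covering.

Section Polytope.
Local Open Scope ring_scope.
Variables (R : realType) (n k : nat) (J : 'I_n -> {set 'I_n}).
Hypothesis n_gt1 : (1 < n)%N.
Hypothesis hJ : grassmann_necklace k J.
Hypothesis hconn : connected_matroid (positroid k J).
Implicit Types (w : 'S_n) (x y : 'rV[R]_n) (a b i r : 'I_n) (B S : {set 'I_n}).

Let P := positroid_polytope R k J.

Lemma polytope_coord_sum S x : P x -> exists c : {set 'I_n} -> R,
  [/\ forall B, B \in positroid k J -> 0 <= c B, \sum_(B in positroid k J) c B = 1 &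
      coord_sum S x = \sum_(B in positroid k J) c B * #|B :&: S|%:R].
Proof.
move=> [c [c0 c1 ->]]; exists c; split => //; rewrite coord_sum_lin.
by apply: eq_bigr => B _; rewrite coord_sum_evec.
Qed.

Lemma polytope_coord_sum_le S m x :
  (forall B, B \in positroid k J -> (#|B :&: S| <= m)%N) -> P x -> coord_sum S x <= m%:R.
Proof.
move=> hm /(polytope_coord_sum S)[c [c0 c1 ->]].
have -> : m%:R = \sum_(B in positroid k J) c B * m%:R by rewrite -mulr_suml c1 mul1r.
apply: ler_sum => B MB.
by rewrite ler_wpM2l ?c0 // ler_nat hm.
Qed.

Lemma polytope_sum x : P x -> \sum_i x 0 i = k%:R.
Proof.
move=> /(polytope_coord_sum [set: 'I_n]%SET)[c [c0 c1 e]].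
have -> : k%:R = \sum_(B in positroid k J) c B * k%:R by rewrite -mulr_suml c1 mul1r.
have -> : \sum_i x 0 i = coord_sum [set: 'I_n]%SET x.
  by apply: eq_bigl => i; rewrite finset.in_setT.
rewrite e; apply: eq_bigr => B /(positroidP hJ)[Bk _].
by rewrite finset.setIT Bk.
Qed.

Lemma polytope_coord x i : P x -> 0 <= x 0 i <= 1.
Proof.
have -> : x 0 i = coord_sum [set i]%SET x by rewrite /coord_sum big_set1.
move=> Px; apply/andP; split.
  have [c [c0 c1 ->]] := polytope_coord_sum [set i]%SET Px.
  by apply: sumr_ge0 => B MB; rewrite mulr_ge0 ?c0.
apply: (@polytope_coord_sum_le _ 1) => // B _.
by rewrite -(cards1 i) subset_leq_card // finset.subsetIr.
Qed.

(* The sets I_r have q or q - 1 elements in the arc, with q = cdes, and the value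
   q occurs; since all weights are positive, a bound j on the mean forces q <= j. *)
Lemma generic_Dset x : P x -> generic x -> exists2 w, w \in Dset k J & Delta R w x.
Proof.
move=> Px gx.
have [w wE [c [c0 c1 xE]]] :=
  generic_Delta n_gt1 (fun i => polytope_coord i Px) (polytope_sum Px) gx.
exists w; last by apply/DeltaP; exists c; split=> // r; exact: ltW.
rewrite inE wE; apply/forallP => i; apply/forallP => j.
set a := a_ J i j; set q := cdesL _ _; rewrite -ltnS -(ltr_nat R).
have le : coord_sum (carc i (dist i a)) x <= (j : nat)%:R.
  apply: polytope_coord_sum_le Px => B /(positroidP hJ)[Bk /(_ i (dist i a))].
  by rewrite card_carc_nth ?hJ.1 //; apply; rewrite ltnW // dist_lt.
have lt : q%:R - 1 < coord_sum (carc i (dist i a)) x.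
  rewrite xE (coord_sum_lin (fun _ => true)) (bigD1 i) //= coord_sum_evec card_I_carc_max -/q.
  have : \sum_(r | r != i) c r * (q%:R - 1) <=
         \sum_(r | r != i) c r * coord_sum (carc i (dist i a)) (evec R (I_ w r)).
    apply: ler_sum => r _; rewrite ler_wpM2l ?(ltW (c0 r)) // coord_sum_evec.
    by rewrite lerBlDr natr1 ler_nat cdesL_restr_le.
  rewrite -mulr_suml; have := c0 i; move: c1; rewrite (bigD1 i) //=.
  set u := \sum_(_ | _) c _; move=> cu ci; have -> : u = 1 - c i by rewrite -cu; ring.
  lra.
rewrite -natr1; lra.
Qed.

Lemma segment_generic x y :
  (forall i (d : 'I_n), (0 < d)%N ->
     coord_sum (carc i d) y != coord_sum (carc i d) x \/
     coord_sum (carc i d) x \isn't a Num.int) ->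
  exists2 e0, 0 < e0 & forall e, 0 < e < e0 -> generic ((1 - e) *: x + e *: y).
Proof.
move=> h.
have [|e0 e00 he] := @uniform_eps R ('I_n * 'I_n)%type (fun p e => (0 < p.2)%N ->
    (1 - e) * coord_sum (carc p.1 p.2) x + e * coord_sum (carc p.1 p.2) y \isn't a Num.int).
  move=> [i d] /=; case: (ltnP 0 d) => d0; last by exists 1.
  by have [e0 e00 he] := segment_nonint (h i d d0); exists e0 => // e /he.
by exists e0 => // e /he hP i d d0; rewrite coord_sumD; exact: (hP (i, d)).
Qed.

Lemma polytope_vertex B : B \in positroid k J -> P (evec R B).
Proof. exact: conv_hull_vertex. Qed.

(** The arcs are treated one by one: a small move towards a suitable basis vertex makes the new
    coordinate sum nonintegral and keeps the earlier ones so. *)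
Lemma exists_generic : exists2 y, P y & generic y.
Proof.
have o : 'I_n by exact: (Ordinal n_gt1).
suff [y Py hy] : exists2 y, P y & forall p, p \in enum {: 'I_n * 'I_n} ->
    (0 < p.2)%N -> coord_sum (carc p.1 p.2) y \isn't a Num.int.
  by exists y => // i d; apply: (hy (i, d)); rewrite mem_enum.
elim: (enum _) => [|[i d] s [y Py hy]].
  by exists (evec R (J o)) => //; apply/polytope_vertex/necklace_positroid.
case: (ltnP 0 d) => d0; last first.
  by exists y => // p; rewrite inE => /predU1P[-> /=|/hy //]; rewrite ltnNge d0.
(* [J o] serves unless it has the same coordinate sum on the arc as [y]; then connectedness provides
   a basis with a different count. *)
have [B MB Bne] : exists2 B, B \in positroid k J & #|B :&: carc i d|%:R != coord_sum (carc i d) y.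
  have [e|ne] := eqVneq (#|J o :&: carc i d|%:R) (coord_sum (carc i d) y); last first.
    by exists (J o) => //; exact: necklace_positroid.
  have [|B MB Bne] := @connected_card_carc_neq _ _ _ hJ i d #|J o :&: carc i d| hconn.
    by rewrite d0 ltn_ord.
  by exists B => //; rewrite -e eqr_nat.
have [|e0 e00 he] := @uniform_eps R ('I_n * 'I_n)%type (fun p e =>
    p \in (i, d) :: s -> (0 < p.2)%N ->
    (1 - e) * coord_sum (carc p.1 p.2) y + e * coord_sum (carc p.1 p.2) (evec R B)
      \isn't a Num.int).
  move=> p; case: (boolP ((p \in (i, d) :: s) && (0 < p.2)%N)) => [/andP[ps p0]|no]; last first.
    by exists 1 => // e _ ps p0; rewrite ps p0 in no.
  suff hp : coord_sum (carc p.1 p.2) (evec R B) != coord_sum (carc p.1 p.2) y \/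
     coord_sum (carc p.1 p.2) y \isn't a Num.int.
    by have [e0 e00 he] := segment_nonint hp; exists e0 => // e /he.
  move: ps; rewrite inE => /predU1P[-> /=|/hy hps]; last by right; exact: hps.
  by left; rewrite coord_sum_evec.
pose e := Num.min e0 1 / 2.
have m0 : 0 < Num.min e0 1 by rewrite lt_min e00 ltr01.
have e_lt : 0 < e < e0.
  have : Num.min e0 1 <= e0 by rewrite ge_min lexx.
  by rewrite /e; lra.
have e_le : 0 <= e <= 1.
  have : Num.min e0 1 <= 1 by rewrite ge_min lexx orbT.
  by rewrite /e; lra.
exists ((1 - e) *: y + e *: evec R B).
  exact: conv_hull_convex e_le Py (polytope_vertex MB).
by move=> p ps p0; rewrite coord_sumD; exact: he.
Qed.

(** Points near [x] on the segment towards a generic [y] are generic, so each lies in some simplex.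
    As there are finitely many words, one [w] serves arbitrarily small parameters, and the
    inequalities of [Delta_tail] pass to the limit [x]. *)
Lemma polytope_cover x : P x -> exists2 w, w \in Dset k J & Delta R w x.
Proof.
move=> Px; have [y Py gy] := exists_generic.
have i0 : 'I_n by exact: (Ordinal n_gt1).
have [|e1 e10 he] := @segment_generic x y.
  move=> i d d0; have [e|] := eqVneq (coord_sum (carc i d) y) (coord_sum (carc i d) x); last by left.
  by right; rewrite -e; exact: gy.
pose z (e : R) := (1 - e) *: x + e *: y.
have [w wD hw] : exists2 w, w \in Dset k J &
    forall e0, 0 < e0 -> exists2 e, 0 < e < e0 & Delta R w (z e).
  apply: contrapT => no.
  (* Otherwise each simplex is avoided below some threshold; below a common threshold all are
     avoided, contradicting the generic case. *)
  have [|e2 e20 h2] := @uniform_eps R 'S_n (fun w e => w \in Dset k J -> ~ Delta R w (z e)).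
    move=> w; apply: contrapT => now; apply: no; exists w.
      apply: contrapT => wD; apply: now; exists 1 => // e _ wD'; exact: wD.
    move=> e0 e00; apply: contrapT => noe; apply: now; exists e0 => // e ee _ De.
    by apply: noe; exists e.
  pose e := Num.min (Num.min e1 e2) 1 / 2.
  have m0 : 0 < Num.min (Num.min e1 e2) 1 by rewrite !lt_min e10 e20 ltr01.
  have m1 : Num.min (Num.min e1 e2) 1 <= 1 by rewrite ge_min lexx orbT.
  have me1 : Num.min (Num.min e1 e2) 1 <= e1 by rewrite !ge_min lexx.
  have me2 : Num.min (Num.min e1 e2) 1 <= e2 by rewrite !ge_min lexx orbT.
  have [w wD De] : exists2 w, w \in Dset k J & Delta R w (z e).
    apply: generic_Dset; last by apply: he; rewrite /e; lra.
    by apply: conv_hull_convex Px Py; rewrite /e; lra.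
  by apply: (h2 e _ w wD De); rewrite /e; lra.
exists w => //; apply/(Delta_tail w x i0); split.
  rewrite (polytope_sum Px); move: wD; rewrite inE => /andP[+ _].
  by rewrite inE => /andP[_ /eqP <-].
have tail_z e i : tail (offset w (z e)) i =
    (1 - e) * tail (offset w x) i + e * tail (offset w y) i.
  rewrite /tail !mulr_sumr -big_split; apply: eq_bigr => j _.
  by rewrite /offset !mxE /=; ring.
move=> a b ab; apply/andP; split; rewrite -subr_ge0.
  apply: (@segment_ge0 _ _ (tail (offset w y) a - tail (offset w y) b)) => e0 /hw[e ee].
  move=> /(Delta_tail w _ i0)[_ /(_ a b ab)]; rewrite !tail_z => hz.
  by exists e => //; lra.
apply: (@segment_ge0 _ _ (tail (offset w y) b + 1 - tail (offset w y) a)) => e0 /hw[e ee].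
move=> /(Delta_tail w _ i0)[_ /(_ a b ab)]; rewrite !tail_z => hz.
by exists e => //; lra.
Qed.

End Polytope.

(** * The triangulation *)

Section Triangulation.
Local Open Scope ring_scope.
Variables (R : realType) (n : nat).
Implicit Types (w : 'S_n) (x : 'rV[R]_n) (A B : {set 'I_n}) (D : {set 'S_n}).

Definition subsimplex w A : set 'rV[R]_n := conv_hull A (fun r => evec R (I_ w r)).

(** The complex of all faces of the simplices for [D], the empty face included. *)
Definition subsimplices D : set (set 'rV[R]_n) :=
  [set S | exists2 w, w \in D & exists A, S = subsimplex w A]%classic.

Lemma subsimplexP w A x :
  subsimplex w A x <-> exists c : 'I_n -> R,
    [/\ forall r, 0 <= c r, forall r, r \notin A -> c r = 0, \sum_r c r = 1 &
        x = \sum_r c r *: evec R (I_ w r)].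
Proof.
split=> [[c [c0 c1 ->]]|[c [c0 cA c1 ->]]].
  exists (fun r => if r \in A then c r else 0); split.
  - by move=> r; case: ifP => // /c0.
  - by move=> r /negbTE ->.
  - by rewrite -big_mkcond.
  rewrite big_mkcond; apply: eq_bigr => r _.
  by case: ifP => _; rewrite ?scale0r.
exists c; split=> //.
  rewrite -c1 [RHS](bigID (mem A)) /= [X in _ = _ + X]big1 ?addr0 // => r /cA //.
rewrite [LHS](bigID (mem A)) /= [X in _ + X]big1 ?addr0 // => r /cA ->.
by rewrite scale0r.
Qed.

Lemma face_subsimplex w A B : B \subset A -> face (subsimplex w B) (subsimplex w A).
Proof.
move=> BA; pose V r := evec R (I_ w r).
(* A presentation as a face needs vertices indexed by an ordinal, so [A] is enumerated; relations
   are extended by zero outside [A] to use the independence for [w]. *)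
exists #|A|, (V \o enum_val), [set i | enum_val i \in B]%SET; split.
- move=> c c0 cE i.
  pose c' r := \sum_(i | enum_val i == r) c i.
  have sum_c' (U : lmodType R) (F : 'I_n -> U) :
      \sum_r c' r *: F r = \sum_i c i *: F (@enum_val _ (mem A) i).
    rewrite [RHS](partition_big (@enum_val _ (mem A)) xpredT) //=.
    by apply: eq_bigr => r _; rewrite scaler_suml; apply: eq_bigr => j /eqP ->.
  have c'0 : forall r, c' r = 0.
    apply: (@Delta_affinely_independent R n w); last by rewrite sum_c' -[RHS]cE.
    rewrite -[RHS]c0; have := sum_c' R^o (fun=> 1).
    by rewrite -!scaler_suml /GRing.scale /= !mulr1.
  have := c'0 (enum_val i); rewrite /c' (big_pred1 i) // => j /=.
  by rewrite (inj_eq enum_val_inj).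
- rewrite eqEsubset; split; apply: conv_hull_subset => i iA.
    by exists (enum_rank_in iA i); rewrite ?inE //= enum_rankK_in.
  by exists (enum_val i) => //; exact: enum_valP.
rewrite eqEsubset; split; apply: conv_hull_subset => i iB.
  have iA := fintype.subsetP BA _ iB.
  by exists (enum_rank_in iA i); rewrite ?inE /= enum_rankK_in.
by exists (enum_val i) => //; move: iB; rewrite inE.
Qed.

Lemma simplex_face (F S : set 'rV[R]_n) : face F S -> simplex S.
Proof. by move=> [m [v [A [ai SE _]]]]; exists m, v. Qed.

(** A face may be presented by another family of vertices; [simplex_vertex] matches these with
    vertices indexed by [A]. *)
Lemma subsimplex_face w A F : face F (subsimplex w A) -> exists B, F = subsimplex w B.
Proof.
move=> [m [v [A0 [ai SE ->]]]].
have hv := simplex_vertex ai (esym SE).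
exists [set j in A | [exists i in A0, v i == evec R (I_ w j)]]%SET.
rewrite eqEsubset; split; apply: conv_hull_subset => i.
  move=> iA; have [j jA e] := hv i; exists j => //; rewrite inE jA.
  by apply/exists_inP; exists i => //; apply/eqP.
rewrite inE => /andP[iA /exists_inP[j jA /eqP e]].
by exists j.
Qed.

(** By [Delta_support], a point of the intersection has positive weight only on vertices common to
    both simplices, so these span the intersection. *)
Lemma face_subsimplexI w w' A A' :
  face (subsimplex w A `&` subsimplex w' A')%classic (subsimplex w A).
Proof.
pose B := [set r in A | [exists r' in A', I_ w' r' == I_ w r]]%SET.
have -> : (subsimplex w A `&` subsimplex w' A')%classic = subsimplex w B.
  rewrite eqEsubset; split=> [x [/subsimplexP[c [c0 cA c1 xE]] /subsimplexP[c' [c0' cA' c1' xE']]]|x xB].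
    apply/subsimplexP; exists c; split=> // r; apply: contraNeq => cr.
    have crp : 0 < c r by rewrite lt_def cr c0.
    have [r' cr' eI] := Delta_support c0 c1 c0' c1' (etrans (esym xE) xE') crp.
    rewrite inE; apply/andP; split; first by apply: contraR cr => /cA ->.
    apply/exists_inP; exists r'; last by rewrite eI.
    by apply: contraTT cr' => /cA' ->; rewrite ltxx.
  split; move: x xB; apply: conv_hull_subset => r; rewrite inE => /andP[rA].
    by exists r.
  by move=> /exists_inP[r' rA' /eqP e]; exists r'; rewrite ?e.
by apply/face_subsimplex/fintype.subsetP => r; rewrite inE => /andP[].
Qed.

Lemma sum_delta (U : lmodType R) (F : 'I_n -> U) r : \sum_i (i == r)%:R *: F i = F r.
Proof.
rewrite (bigD1 r) //= eqxx scale1r big1 ?addr0 // => i /negbTE ->.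
by rewrite scale0r.
Qed.

Lemma I_inj w : injective (I_ w).
Proof.
move=> r r' e; apply/eqP; apply: contraT => rr'.
pose c i : R := (i == r)%:R - (i == r')%:R.
have : c r = 0.
  apply: (@Delta_affinely_independent R n w).
    rewrite sumrB; have d (i0 : 'I_n) : \sum_(i < n) (i == i0)%:R = 1 :> R.
      have := sum_delta (fun=> 1 : R^o) i0; rewrite -scaler_suml.
      by rewrite /GRing.scale /= mulr1.
    by rewrite !d subrr.
  under eq_bigr do rewrite scalerBl.
  by rewrite sumrB !sum_delta e subrr.
by rewrite /c eqxx (negbTE rr') subr0 => /eqP; rewrite oner_eq0.
Qed.

(** The n distinct vertices of [Delta R w] must be vertices of the larger simplex. The resulting
    injection of indices into [A] is a bijection, so no further vertex is available. *)
Lemma Delta_maximal w w' A : (Delta R w `<=` subsimplex w' A)%classic ->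
  subsimplex w' A = Delta R w.
Proof.
move=> sub; have hv r : exists2 j, j \in A & I_ w' j = I_ w r.
  apply: (@evec_conv_hull R n); apply: sub; apply: conv_hull_vertex.
  by rewrite finset.in_setT.
have [f hf] := choice (fun r => let: ex_intro2 j jA jE := hv r in ex_intro _ j (conj jA jE)).
have f_inj : injective f.
  by move=> r r' e; apply: (@I_inj w); rewrite -(hf r).2 -(hf r').2 e.
rewrite eqEsubset; split=> //; apply: conv_hull_subset => j jA.
have [g fg gf] := injF_bij f_inj.
by exists (g j); rewrite ?finset.in_setT // -(hf (g j)).2 gf.
Qed.

Lemma finite_subsimplices D : finite_set (subsimplices D).
Proof.
apply: (@sub_finite_set _ _ ((fun p : 'S_n * {set 'I_n} => subsimplex p.1 p.2) @` setT)%classic).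
  by move=> S [w _ [A ->]]; exists (w, A).
exact/finite_image/finite_finset.
Qed.

(** The incidence properties hold for any set [D] of words; only the union has to be identified with
    the polytope. *)
Lemma subsimplices_triangulation D (P : set 'rV[R]_n) :
  P = (\bigcup_(w in [set w | w \in D]) Delta R w)%classic ->
  triangulation (subsimplices D) P /\
  maximal_simplices (subsimplices D) = [set Delta R w | w in [set w | w \in D]]%classic.
Proof.
move=> PE; split; first split.
- exact: finite_subsimplices.
- by move=> S [w _ [A ->]]; apply: simplex_face (face_subsimplex w (fintype.subxx A)).
- move=> S F [w wD [A ->]] /subsimplex_face[B ->].
  by exists w => //; exists B.
- move=> S S' [w _ [A ->]] [w' _ [A' ->]]; split; first exact: face_subsimplexI.
  by rewrite setIC; exact: face_subsimplexI.
- rewrite PE eqEsubset; split=> [x [w wD xw]|x [S [w wD [A ->]] xS]].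
    by exists (Delta R w) => //; exists w => //; exists [set: 'I_n]%SET.
  exists w => //; move: x xS; apply: conv_hull_subset => r _.
  by exists r; rewrite ?finset.in_setT.
rewrite eqEsubset; split=> [S [[w wD [A SE]] max]|_ [w wD <-]].
  exists w => //; apply: max; first by exists w => //; exists [set: 'I_n]%SET.
  rewrite SE; apply: conv_hull_subset => r _.
  by exists r; rewrite ?finset.in_setT.
split; first by exists w => //; exists [set: 'I_n]%SET.
by move=> _ [w' _ [A ->]]; exact: Delta_maximal.
Qed.

End Triangulation.

Theorem theorem3p11 (R : realType) (n k : nat) (J : 'I_n -> {set 'I_n})
    (hn : 1 < n) (hk : 1 <= k <= n)
    (hJ : grassmann_necklace k J)
    (hconn : connected_matroid (positroid k J)) :
  Dset k J =
    [set w in Eset n k | [forall r : 'I_n, forall j : 'I_n,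
                            gale_le j (J j) (I_ w r)]]%SET /\
  (exists K : set (set 'rV[R]_n),
     triangulation K (positroid_polytope R k J) /\
     maximal_simplices K =
       [set Delta R w | w in [set w | w \in Dset k J]]%classic) /\
  positroid_polytope R k J =
    (\bigcup_(w in [set w | w \in Dset k J]) Delta R w)%classic.
Proof.
have DE := Dset_gale hJ.1.
have PE : positroid_polytope R k J =
    (\bigcup_(w in [set w | w \in Dset k J]) Delta R w)%classic.
  rewrite eqEsubset; split=> [x Px|x [w /= wD xw]].
    by have [w wD xw] := polytope_cover hn hJ hconn Px; exists w.
  (* For the reverse inclusion, the Gale description of [Dset] says that every vertex $I_r(w)$ is a
     basis. *)
  move: wD; rewrite DE inE => /andP[]; rewrite inE => /andP[_ /eqP wk] /forallP hI.
  move: x xw; apply: conv_hull_subset => r _; exists (I_ w r) => //.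
  by rewrite inE (_ : #|I_ w r| = k) ?eqxx //= card_I_ -[RHS]wk.
split=> //; split=> //.
by exists (@subsimplices R n (Dset k J)); exact: subsimplices_triangulation.
Qed.
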